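(* Suppose that $(X,\mathcal{E})$ and $(Y,\mathcal{F})$ are small and uniformly locally finite coarse spaces. Let $\Phi\colon \mathrm{C}^*_u(Y)\to \mathrm{C}^*_u(X)$ be an isomorphism. Then for every $F\in\mathcal{F}$ and every $\varepsilon>0$ there exists $E\in\mathcal{E}$ such that $\Phi(T)$ can be $\varepsilon$-$E$-approximated for all $T\in \mathrm{C}^*_u(Y)$ with $\mathrm{supp}(T)\subseteq F$ and $\|T\|\le 1$.
   Context: Coarse structures. A coarse structure on a set $X$ is a collection $\mathcal{E}$ of subsets of $X\times X$ (called entourages) which contains the diagonal $\Delta_X=\{(x,x): x\in X\}$ and is closed under taking subsets, inverses $E^{-1}=\{(x,y):(y,x)\in E\}$, finite unions, and compositions $E\circ F=\{(x,y): \exists z\ (x,z)\in E,\ (z,y)\in F\}$; $(X,\mathcal{E})$ is a coarse space. The coarse structure generated by a family of subsets of $X\times X$ is the smallest coarse structure containing it; the family is then called a set of generators. A coarse space $(X,\mathcal{E})$ is uniformly locally finite if $\sup_{x\in X}|\{y\in X:(x,y)\in E\}|<\infty$ for all $E\in\mathcal{E}$. Smallness. Let $\mathbb{D}=\{z\in\mathbb{C}:|z|\le 1\}$ with its usual topology and give $\mathbb{D}^J$ the product topology. $\mathrm{cov}(\mathbb{D}^J)$ is the minimal cardinality of a family of nowhere dense subsets of $\mathbb{D}^J$ covering $\mathbb{D}^J$. Let $|\mathcal{E}|_{\min}$ be the minimal cardinality of a set of generators of $\mathcal{E}$. The coarse space $(X,\mathcal{E})$ is small if $\mathrm{cov}(\mathbb{D}^{X})>|\mathcal{E}|_{\min}$.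 Uniform Roe algebras. For $T\in B(\ell_2(X))$ let $\mathrm{supp}(T)=\{(x,x'):\langle T\delta_x,\delta_{x'}\rangle\ne 0\}$. The uniform Roe algebra $\mathrm{C}^*_u(X)$ is the norm closure in $B(\ell_2(X))$ of $\{T\in B(\ell_2(X)): \mathrm{supp}(T)\in\mathcal{E}\}$. Isomorphisms of C*-algebras are $*$-isomorphisms. Approximation. For $\varepsilon>0$ and $E\in\mathcal{E}$, an operator $T\in B(\ell_2(X))$ can be $\varepsilon$-$E$-approximated if there is $S\in \mathrm{C}^*_u(X)$ with $\mathrm{supp}(S)\subseteq E$ and $\|T-S\|\le\varepsilon$. *)

(* Defs.v *)
From HB Require Import structures.
From mathcomp Require Import all_boot all_order all_algebra finmap lra.
From mathcomp Require Import complex.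
From mathcomp Require Import all_classical all_reals all_analysis.
From mathcomp.analysis.showcase Require summability.

Set Implicit Arguments.
Unset Strict Implicit.
Unset Printing Implicit Defensive.

Import Order.TTheory GRing.Theory Num.Theory.
Import numFieldTopology.Exports numFieldNormedType.Exports.
Import ComplexField.Normc.

Local Open Scope classical_set_scope.
Local Open Scope card_scope.
Local Open Scope ring_scope.
Local Open Scope complex_scope.

Section Coarse.
Variable X : Type.
Implicit Types (E F : set (X * X)) (EE G : set (set (X * X))).

Record coarse_structure EE : Prop := CoarseStructure {
  coarse_diag : EE [set xy | xy.1 = xy.2];
  coarse_sub : forall E F, F `<=` E -> EE E -> EE F;
  coarse_inv : forall E, EE E -> EE (E^-1)%relation;
  coarse_union : forall E F, EE E -> EE F -> EE (E `|` F);
  coarse_comp : forall E F, EE E -> EE F -> EE (E \; F)%relation }.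

Definition generates EE G : Prop := smallest coarse_structure G = EE.

Definition uniformly_locally_finite EE : Prop :=
  forall E, EE E -> exists n : nat, forall x, [set y | E (x, y)] #<= `I_n.

End Coarse.

(** There is no type of cardinals: the minimal cardinality of the sets satisfying
    [P] is represented by any set [A] such that [least_card P A].  Such a set
    exists as soon as [P] is inhabited, see [least_card_exists]. *)

Definition card_lt T U (A : set T) (B : set U) : Prop :=
  A #<= B /\ ~ (B #<= A).

Definition least_card T (P : set (set T)) (A : set T) : Prop :=
  P A /\ forall B, P B -> A #<= B.

Lemma least_card_exists T (P : set (set T)) :
  P !=set0 -> exists A, least_card P A.
Proof.
move=> [A0 PA0].
pose good (S : set (set T -> T)) :=
  (forall f A, S f -> P A -> A (f A)) /\
  (forall f g A, S f -> S g -> P A -> f A = g A -> f = g).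
have [F goodF Ftot|S [[Sin Sinj] Smax]] := @Zorn_bigcup _ good.
  split=> [f A [D FD Df] PA|f g A [D FD Df] [D' FD' D'g] PA fg].
    by have [h _] := goodF _ FD; exact: (h f A Df PA).
  have [DD'|D'D] := Ftot _ _ FD FD'.
    by have [_ h] := goodF _ FD'; apply: (h _ _ A) => //; exact: DD'.
  by have [_ h] := goodF _ FD; apply: (h _ _ A) => //; exact: D'D.
have [[A [PA AS]]|noA] :=
    pselect (exists A, P A /\ A `<=` [set f A | f in S]).
  exists A; split=> // B PB.
  apply: (card_le_trans (subset_card_le AS)).
  apply: (card_le_trans (card_image_le _ _)).
  have injB : set_inj S (fun f => f B).
    by move=> f g /set_mem Sf /set_mem Sg; exact: Sinj.
  rewrite -(card_le_eql (inj_card_eq injB)).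
  by apply: subset_card_le => _ [f Sf <-]; exact: (Sin f B Sf PB).
have ex A : exists a, P A -> A a /\ forall g, S g -> g A <> a.
  have new B : P B -> exists2 b, B b & forall g, S g -> g B <> b.
    move=> PB; apply: contrapT => nob; apply: noA; exists B; split=> // b Bb.
    apply: contrapT => nSb; apply: nob; exists b => // g Sg gb.
    by apply: nSb; exists g.
  have [PA|nPA] := pselect (P A); last by have [a] := new _ PA0; exists a.
  by have [a] := new _ PA; exists a.
have [f fP] := choice ex.
exfalso; apply: (Smax (S `|` [set f])).
  split; first by move=> g Sg; left.
  by move=> /(_ f (or_intror erefl)) Sf; have [_ /(_ f Sf)] := fP _ PA0.
split=> [g A [Sg|->] PA|g h A [Sg|->] [Sh|->] PA //].
- exact: (Sin g A Sg PA).
- by have [] := fP _ PA.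
- exact: (Sinj g h A Sg Sh PA).
- by have [_ /(_ _ Sg)] := fP _ PA.
- by move=> /esym; have [_ /(_ _ Sh)] := fP _ PA.
Qed.

Definition nowhere_dense (T : topologicalType) (A : set T) : Prop :=
  interior (closure A) = set0.

Section Small.
Variable R : realType.

(** [R[i]^o] is [R[i]] with the topology given by its modulus. *)
Definition cdisk : set R[i]^o := [set z | `|z| <= 1].

Definition nowhere_dense_cover (J : Type)
    (N : set (set {ptws J -> set_type cdisk})) : Prop :=
  (forall A, N A -> nowhere_dense A) /\ \bigcup_(A in N) A = setT.

(** [least_card (generates EE) G] stands for [#G = |EE|_min] and
    [least_card (@nowhere_dense_cover X) N] for [#N = cov(D^X)].  When [X] is
    empty, [D^X] is a point and has no such cover: [cov] is then infinite and
    [EE] is small. *)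
Definition small (X : Type) (EE : set (set (X * X))) : Prop :=
  forall G N, least_card (generates EE) G ->
    least_card (@nowhere_dense_cover X) N -> card_lt G N.

End Small.

Section Ell2.
Variables (R : realType) (X : choiceType).
Local Notation C := R[i]^o.

Definition ell2_pred : {pred X -> C} :=
  mem [set f : X -> C | summable setT (fun x => (normc (f x) ^+ 2)%:E)].

Record ell2 := Ell2 { ell2_fun :> X -> C; _ : ell2_fun \in ell2_pred }.

HB.instance Definition _ := [isSub for ell2_fun].
HB.instance Definition _ := [Choice of ell2 by <:].

Lemma ell2_pred_closed : GRing.submod_closed ell2_pred.
Proof.
have normc_ge0 (z : R[i]) : 0 <= normc z by case: z => a b; exact: sqrtr_ge0.
split=> [|a f g].
  rewrite inE /=/summable esum1 // => x _.
  by rewrite expr0n /= addr0 sqrtr0 expr0n /= normr0.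
rewrite !inE /= => sf sg.
have bnd h k : summable setT h -> (forall x : X, 0%E <= (k x : R)%:E)%E ->
    (forall x, (k x)%:E <= `|h x|)%E -> summable setT (fun x => (k x)%:E).
  move=> sh k0 kh; apply: le_lt_trans sh; apply: le_esum => x _.
  by rewrite gee0_abs.
have sum0 h (c : R) : 0 <= c -> summable setT (fun x : X => (h x : R)%:E) ->
    (forall x, 0 <= h x) -> summable setT (fun x => (c * h x)%:E).
  move=> c0 sh h0; rewrite /summable.
  apply: (@le_lt_trans _ _ (c%:E * \esum_(x in setT) `|(h x)%:E|)%E).
    apply: ub_ereal_sup => _ [F [finF FT] <-].
    under eq_fsbigr do rewrite gee0_abs ?lee_fin ?mulr_ge0 // EFinM.
    rewrite -ge0_mule_fsumr; last by move=> x; rewrite lee_fin.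
    apply: lee_wpmul2l; first by rewrite lee_fin.
    apply: ereal_sup_ubound; exists F => //.
    by apply: eq_fsbigr => x _; rewrite gee0_abs ?lee_fin.
  by apply: lte_mul_pinfty => //; rewrite ?lee_fin //; exact: esum_ge0.
have sq_ge0 h (x : X) : 0 <= normc (h x : C) ^+ 2 by rewrite sqr_ge0.
have sf2 := sum0 _ (2 * normc a ^+ 2) (mulr_ge0 (ler0n _ 2) (sqr_ge0 _)) sf (sq_ge0 f).
have sg2 := sum0 _ 2 (ler0n _ 2) sg (sq_ge0 g).
apply: (bnd _ _ (summableD sf2 sg2)) => x; first by rewrite lee_fin.
rewrite gee0_abs ?adde_ge0 ?lee_fin ?mulr_ge0 //.
rewrite -[(a *: f + g) x]/(a * f x + g x : R[i]).
apply: (@le_trans _ _ ((normc (a * f x) + normc (g x)) ^+ 2)).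
  by rewrite ler_sqr ?nnegrE ?addr_ge0 // le_normcD.
rewrite normcM -mulrA -exprMn.
set p := _ * _; set q := normc (g x).
have := sqr_ge0 (p - q); rewrite !expr2.
lra.
Qed.

HB.instance Definition _ := GRing.isSubmodClosed.Build R[i] (X -> C) ell2_pred
  ell2_pred_closed.
HB.instance Definition _ := [SubChoice_isSubLmodule of ell2 by <:].


Definition ell2_norm (u : ell2) : R :=
  Num.sqrt (fine (\esum_(x in setT) (normc (u x) ^+ 2)%:E)).

(** Linear in the first variable; the unordered sum is the limit along the
    finite subsets of [X]. *)
Definition inner (u v : ell2) : C := summability.sum (fun x => u x * (v x)^*).

Lemma delta_subproof (x : X) : (fun y => (y == x)%:R : C) \in ell2_pred.
Proof.
rewrite inE /= /summable.
rewrite (eq_esum (b := fun y => if y \in [set x] then 1%E else 0%E)).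
  by rewrite -esum_mkcond esum_set1 // ltry.
move=> y _; rewrite in_set1; case: eqP => _.
  by rewrite normc1 expr1n abse1.
by rewrite normc0 expr0n abse0.
Qed.

Definition delta (x : X) : ell2 := Ell2 (delta_subproof x).

Implicit Types T S : ell2 -> ell2.

Definition bounded_operator T : Prop :=
  linear T /\ exists M : R, forall u, ell2_norm (T u) <= M * ell2_norm u.

Definition opnorm T : R :=
  sup [set ell2_norm (T u) | u in [set u | ell2_norm u <= 1]].

Definition is_adjoint T S : Prop := forall u v, inner (T u) v = inner u (S v).

Definition supp T : set (X * X) :=
  [set xy | inner (T (delta xy.1)) (delta xy.2) != 0].

Variable EE : set (set (X * X)).

Definition uniform_roe : set (ell2 -> ell2) :=
  [set T | bounded_operator T /\ forall e : R, 0 < e ->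
    exists S, [/\ bounded_operator S, EE (supp S) & opnorm (T - S) <= e]].

Definition approximated (e : R) (E : set (X * X)) T : Prop :=
  exists S, [/\ uniform_roe S, supp S `<=` E & opnorm (T - S) <= e].

End Ell2.

(** [A] and [B] are meant to be [*]-subalgebras of the bounded operators; only
    the values of [Phi] on [A] matter. The last field says that
    [Phi T^* = (Phi T)^*]: adjoints of bounded operators exist and are unique,
    hence [is_adjoint T S] amounts to [S = T^*]. *)
Record star_isomorphism (R : realType) (X Y : choiceType)
    (A : set (ell2 R X -> ell2 R X)) (B : set (ell2 R Y -> ell2 R Y))
    (Phi : (ell2 R X -> ell2 R X) -> (ell2 R Y -> ell2 R Y)) : Prop :=
  StarIsomorphism {
    star_iso_bij : set_bij A B Phi;
    star_isoD : forall S T, A S -> A T -> Phi (S + T) = Phi S + Phi T;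
    star_isoZ : forall (a : R[i]) T, A T -> Phi (a *: T) = a *: Phi T;
    star_isoM : forall S T, A S -> A T -> Phi (S \o T) = Phi S \o Phi T;
    star_isoJ : forall T S, A T -> A S ->
      is_adjoint T S -> is_adjoint (Phi T) (Phi S) }.

(* Main.v *)
Require Import Defs.
From mathcomp Require Import all_boot all_order all_algebra finmap lra ring.
From mathcomp Require Import complex.
From mathcomp Require Import all_classical all_reals all_analysis.
From mathcomp.analysis.showcase Require summability.

(** Decomposing an entourage [F] into finitely many graphs of partial injections
    writes every contraction supported on [F] as [sum_k D_k V_k] with fixed
    partial isometries [V_k] and diagonal contractions [D_k], so it suffices to
    approximate the operators [Phi D_l] uniformly over [l] in the polydisk
    [D^Y]. For [e > 0] and [E] in [EE] the set [A_E] of those [l] such that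
    [Phi D_l] is [e]-[E]-approximable is closed: the matrix entries of [Phi D_l]
    depend continuously on [l], because compression to [delta_x] is pulled back
    by [Phi] to compression by a minimal idempotent, and an approximant can be
    sought in a compact set of matrices. The [A_E], with [E] in a cofinal
    family, cover [D^Y]. Such a family can be chosen countable or of the
    cardinality of a least set of generators, so smallness, or the Baire
    category theorem when the generators are finite in number, gives some [A_E]
    with an interior point: there, all coordinates outside a finite set are
    free, and the finitely many remaining ones cost only finitely many
    operators. As smallness concerns [cov(D^X)], it has to be compared to
    [cov(D^Y)], which uses an injection of [Y] into [X]. *)

Set Implicit Arguments.
Unset Strict Implicit.
Unset Printing Implicit Defensive.

Import Order.TTheory GRing.Theory Num.Theory.
Import numFieldTopology.Exports numFieldNormedType.Exports.
Import ComplexField.Normc.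

Local Open Scope classical_set_scope.
Local Open Scope card_scope.
Local Open Scope ring_scope.
Local Open Scope complex_scope.

(** * Cardinals and cofinal families of entourages *)

Lemma card_le_intro T U (A : set T) (B : set U) (f : T -> U) :
  (forall a, A a -> B (f a)) ->
  (forall a a', A a -> A a' -> f a = f a' -> a = a') -> A #<= B.
Proof.
move=> fAB finj.
have injf : set_inj A f by move=> a a' /set_mem Aa /set_mem Aa'; exact: finj.
rewrite -(card_le_eql (inj_card_eq injf)).
by apply: subset_card_le => _ [a Aa <-]; exact: fAB.
Qed.

(** The map is total on [T]: off [A] it takes a fixed value in [B], which is why [B] has to be
    inhabited. *)
Lemma card_le_elim T U (A : set T) (B : set U) : B !=set0 -> A #<= B ->
  exists f : T -> U, (forall a, A a -> B (f a)) /\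
    (forall a a', A a -> A a' -> f a = f a' -> a = a').
Proof.
move=> [b Bb] /card_leP[g].
exists (fun a => if pselect (A a) is left Aa then val (g (SigSub (mem_set Aa)))
  else b); split=> [a Aa|a a' Aa Aa'].
  by case: pselect => // Aa'; exact/set_mem/valP.
case: pselect => // {}Aa; case: pselect => // {}Aa' /val_inj.
by move=> /(@inj _ _ _ g _ _ (mem_set I) (mem_set I)) [].
Qed.

(** Cardinals compare because the two-element family made of [A] and [B] has a member of least
    cardinality. *)
Lemma card_le_total T (A B : set T) : A #<= B \/ B #<= A.
Proof.
have [|C [[->|->] CP]] := @least_card_exists T [set C | C = A \/ C = B].
- by exists A; left.
- by left; apply: CP; right.
- by right; apply: CP; left.
Qed.

Section Square.
Variables (T : Type) (A : set T).

(** The set is read off the diagonal of the graph, so that a single relation records both a subset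
    and an injection from its square to itself, and chains of such data have unions. *)
Let dom (S : set (T * T * T)) : set T := [set a | exists c, S (a, a, c)].

Let pairing (S : set (T * T * T)) :=
  [/\ forall a b, dom S a -> dom S b -> exists c, S (a, b, c),
      forall a b c, S (a, b, c) -> [/\ dom S a, dom S b & dom S c],
      forall p c c', S (p, c) -> S (p, c') -> c = c',
      forall p p' c, S (p, c) -> S (p', c) -> p = p' &
      dom S `<=` A].

(* Zorn's lemma on the graphs of injections from [B * B] to [B], where [B] is a
   subset of [A] that contains a fixed copy of [nat]: for a maximal one, the
   complement of [B] embeds into [B]. *)
Lemma square_card_le : infinite_set A -> A `*` A #<= A.
Proof.
move=> /infiniteP Ainf.
have Ane : A !=set0.
  have [A0|/set0P//] := eqVneq A set0.
  have : [set: nat] #<= @set0 T by rewrite -A0.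
  by rewrite card_le0 => /eqP/seteqP[/(_ 0%N)]; case.
have [io [ioA ioinj]] := card_le_elim Ane Ainf.
have {ioA}ioA n : A (io n) by exact: ioA.
have {ioinj}ioinj : injective io by move=> m n; exact: ioinj.
pose S0 : set (T * T * T) :=
  [set q | exists m n, q = (io m, io n, io (choice.pickle (m, n)))].
have S0P : pairing S0.
  have dS0 a : dom S0 a <-> exists n, a = io n.
    split=> [[c [m [n [-> _ _]]]]|[n ->]]; first by exists m.
    by exists (io (choice.pickle (n, n))), n, n.
  split.
  - by move=> a b /dS0[m ->] /dS0[n ->]; exists (io (choice.pickle (m, n))), m, n.
  - move=> a b c [m [n [-> -> ->]]].
    by split; apply/dS0; [exists m|exists n|exists (choice.pickle (m, n))].
  - by move=> p c c' [m [n [-> ->]]] [m' [n' [/ioinj-> /ioinj-> ->]]].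
  - move=> p p' c [m [n [-> ->]]] [m' [n' [-> /ioinj/(pcan_inj choice.pickleK)]]].
    by case=> -> ->.
  - by move=> a /dS0[n ->].
(* [S0] is added inside the predicate so that the union [set0] of the empty chain satisfies it. *)
have [|S [SP Smax]] := @Zorn_bigcup _ [set S | pairing (S0 `|` S)].
  move=> F FP Ftot.
  have [->|/set0P[W FW]] := eqVneq F set0; first by rewrite /= bigcup_set0 setU0.
  set V := \bigcup_(X in F) X.
  have in1 q : (S0 `|` V) q -> exists2 X, F X & (S0 `|` X) q.
    by move=> [?|[X FX Xq]]; [exists W => //; left|exists X => //; right].
  have in2 q q' : (S0 `|` V) q -> (S0 `|` V) q' ->
      exists X, [/\ F X, (S0 `|` X) q & (S0 `|` X) q'].
    move=> /in1[X FX Xq] /in1[Y FY Yq].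
    have [XY|YX] := Ftot _ _ FX FY.
      by exists Y; split=> //; move: Xq; apply: setUS.
    by exists X; split=> //; move: Yq; apply: setUS.
  have sub X : F X -> S0 `|` X `<=` S0 `|` V.
    by move=> FX; apply: setUS => q Xq; exists X.
  have dsub X : F X -> dom (S0 `|` X) `<=` dom (S0 `|` V).
    by move=> FX a [c /(sub _ FX)]; exists c.
  split.
  - move=> a b [c Vc] [d Vd]; have [X [FX Xc Xd]] := in2 _ _ Vc Vd.
    have [+ _ _ _ _] := FP _ FX; case/(_ a b); [by exists c|by exists d|].
    by move=> e Xe; exists e; exact: sub Xe.
  - move=> a b c /in1[X FX Xq]; have [_ /(_ _ _ _ Xq)[? ? ?] _ _ _] := FP _ FX.
    by split; apply: (dsub X FX).
  - move=> p c c' Vc Vd; have [X [FX Xc Xd]] := in2 _ _ Vc Vd.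
    by have [_ _ h _ _] := FP _ FX; apply: h Xc Xd.
  - move=> p c c' Vc Vd; have [X [FX Xc Xd]] := in2 _ _ Vc Vd.
    by have [_ _ _ h _] := FP _ FX; apply: h Xc Xd.
  - move=> a [c /in1[X FX Xq]]; have [_ _ _ _ h] := FP _ FX.
    by apply: h; exists c.
set S1 := S0 `|` S in SP; set B := dom S1.
have [tot cl fun_ injS BA] := SP.
have Bt n : B (io n) by exists (io (choice.pickle (n, n))); left; exists n, n.
have /choice[f0 f0S] : forall p : T * T, exists c,
    B p.1 -> B p.2 -> S1 (p, c).
  move=> [a b] /=; have [[Ba Bb]|nB] := pselect (B a /\ B b).
    by have [c Sc] := tot a b Ba Bb; exists c.
  by exists (io 0%N) => Ba Bb; case: nB.
pose f a b := f0 (a, b).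
have fS a b : B a -> B b -> S1 (a, b, f a b) by exact: (f0S (a, b)).
have fB a b : B a -> B b -> B (f a b).
  by move=> Ba Bb; have [] := cl _ _ _ (fS a b Ba Bb).
have finj a b a' b' : B a -> B b -> B a' -> B b' -> f a b = f a' b' ->
    a = a' /\ b = b'.
  move=> Ba Bb Ba' Bb' e; have h := fS a b Ba Bb; rewrite e in h.
  by have [] := injS _ _ _ h (fS a' b' Ba' Bb').
(* If [B] embeds into its complement by [phi], the pairing extends to the union of [B] and its
   image, against maximality. *)
have [le|le] := card_le_total B (A `\` B).
  exfalso.
  have [|phi [phiA phiinj]] := card_le_elim _ le.
    apply/set0P/negP => /eqP e; move: le; rewrite e card_le0 => /eqP/seteqP[+ _].
    by move=> /(_ _ (Bt 0%N)).
  (* The three kinds of new pairs all take values in the image of [phi]; the tag [io i] keeps these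
     values apart. *)
  pose t1 (a b : T) (i : nat) := phi (f (io i) (f a b)).
  pose N : set (T * T * T) := [set q | exists a b, [/\ B a, B b &
     [\/ q = (phi a, phi b, t1 a b 0%N), q = (a, phi b, t1 a b 1%N)
       | q = (phi a, b, t1 a b 2%N)]]].
  have phiB a : B a -> ~ B (phi a) by move=> /phiA[].
  have t1B a b i : B a -> B b -> B (f (io i) (f a b)).
    by move=> Ba Bb; exact: fB _ _ (Bt i) (fB _ _ Ba Bb).
  have t1inj a b i a' b' i' : B a -> B b -> B a' -> B b' ->
      t1 a b i = t1 a' b' i' -> [/\ a = a', b = b' & i = i'].
    move=> Ba Bb Ba' Bb' /(phiinj _ _ (t1B _ _ _ Ba Bb) (t1B _ _ _ Ba' Bb')).
    move=> /finj[]//; try exact: fB.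
    by move=> /ioinj -> /finj[].
  apply: (Smax (S `|` N)).
    split=> [q Sq|sub]; first by left.
    have Sq : S (phi (io 0%N), phi (io 0%N), t1 (io 0%N) (io 0%N) 0%N).
      by apply: sub; right; exists (io 0%N), (io 0%N); split=> //; constructor.
    by have [/(phiB _ (Bt 0%N))] := cl _ _ _ (or_intror Sq : S1 _).
  rewrite /= setUA -/S1.
  have dN a : dom (S1 `|` N) a <-> B a \/ exists2 b, B b & a = phi b.
    split.
      move=> [c [Sc|[x [y [Bx By [[-> _ _]|[-> e _]|[e e' _]]]]]]].
      - by left; exists c.
      - by right; exists x.
      - by case: (phiB _ By); rewrite -e.
      - by case: (phiB _ Bx); rewrite -e e'.
    move=> [[c Sc]|[b Bb ->]]; first by exists c; left.
    by exists (t1 b b 0%N); right; exists b, b; split=> //; constructor.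
  have Nout p c : N (p, c) -> ~ B c.
    by move=> [x [y [Bx By [[_ ->]|[_ ->]|[_ ->]]]]]; apply: phiB; exact: t1B.
  have Npout a b c : N (a, b, c) -> ~ (B a /\ B b).
    by move=> [x [y [Bx By [[-> _ _]|[_ -> _]|[-> _ _]]]]] [h k];
      [exact: phiB Bx h|exact: phiB By k|exact: phiB Bx h].
  split.
  - move=> a b /dN[Ba|[x Bx ->]] /dN[Bb|[y By ->]].
    + by have [c ?] := tot a b Ba Bb; exists c; left.
    + by exists (t1 a y 1%N); right; exists a, y; split=> //; constructor.
    + by exists (t1 x b 2%N); right; exists x, b; split=> //; constructor.
    + by exists (t1 x y 0%N); right; exists x, y; split=> //; constructor.
  - move=> a b c [/cl[Ba Bb Bc]|[x [y [Bx By h]]]].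
      by split; apply/dN; left.
    have dB z : B z -> dom (S1 `|` N) z by move=> Bz; apply/dN; left.
    have dphi z : B z -> dom (S1 `|` N) (phi z).
      by move=> Bz; apply/dN; right; exists z.
    by case: h => [] [-> -> ->]; split; (exact: dB || apply: dphi => //);
      exact: t1B.
  - move=> [a b] c c' [Sc|Nc] [Sc'|Nc'].
    + exact: fun_ Sc Sc'.
    + by have [Ba Bb _] := cl _ _ _ Sc; case: (Npout _ _ _ Nc').
    + by have [Ba Bb _] := cl _ _ _ Sc'; case: (Npout _ _ _ Nc).
    + move: Nc Nc' => [x [y [Bx By h]]] [x' [y' [Bx' By' h']]].
      have pi u v : B u -> B v -> phi u = phi v -> u = v by move=> *; exact: phiinj.
      case: h h' => [] [-> -> ->] [] [] e e' ->; subst;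
      first [ by rewrite (pi _ _ Bx Bx') // (pi _ _ By By')
            | by rewrite (pi _ _ By By')
            | by rewrite (pi _ _ Bx Bx')
            | by exfalso; match goal with h : B (phi ?x), k : B ?x |- _ =>
                exact: (phiB _ k h) end
            | idtac].
  - move=> [a b] [a' b'] c [Sc|Nc] [Sc'|Nc'].
    + exact: injS Sc Sc'.
    + by have [_ _ Bc] := cl _ _ _ Sc; case: (Nout _ _ Nc').
    + by have [_ _ Bc] := cl _ _ _ Sc'; case: (Nout _ _ Nc).
    + move: Nc Nc' => [x [y [Bx By h]]] [x' [y' [Bx' By' h']]].
      by case: h h' => [] [-> -> ->] [] [-> -> /t1inj[]] // -> ->.
  - move=> a /dN[/BA//|[b Bb ->]].
    by have [] := phiA _ Bb.
(* Now the complement of [B] embeds into [B], hence so does [A], with [io 0%N] and [io 1%N] marking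
   the two pieces; the pairing of [B] then serves for [A]. *)
have [psi [psiB psiinj]] := card_le_elim (ex_intro _ _ (Bt 0%N)) le.
pose g a := if pselect (B a) then f (io 0%N) a else f (io 1%N) (psi a).
have gB a : A a -> B (g a).
  by move=> Aa; rewrite /g; case: pselect => Ba; apply: fB => //; exact: psiB.
have ginj a a' : A a -> A a' -> g a = g a' -> a = a'.
  move=> Aa Aa'; rewrite /g; case: pselect => Ba; case: pselect => Ba' /finj[]//;
    try exact: psiB; try by move=> /ioinj.
  by move=> _; apply: psiinj.
apply: (@card_le_intro _ _ _ _ (fun p => f (g p.1) (g p.2))).
  by move=> [a b] [/= Aa Ab]; apply: BA; apply: fB; exact: gB.
move=> [a b] [a' b'] [/= Aa Ab] [/= Aa' Ab'] /finj[]; try exact: gB.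
by move=> /ginj -> // /ginj ->.
Qed.

End Square.

(** Taking subsets has no constructor: it would spoil the cardinality of the set of terms, and
    cofinality absorbs it. *)
Inductive coarse_term (T : Type) :=
| CTdiag | CTgen of T | CTinv of coarse_term T
| CTunion of coarse_term T & coarse_term T
| CTcomp of coarse_term T & coarse_term T.
Arguments CTdiag {T}.

Section CoarseTerms.
Variable X : Type.

Fixpoint ct_eval (t : coarse_term (set (X * X))) : set (X * X) :=
  match t with
  | CTdiag => [set xy | xy.1 = xy.2]
  | CTgen E => E
  | CTinv t => (ct_eval t)^-1%relation
  | CTunion t u => ct_eval t `|` ct_eval u
  | CTcomp t u => (ct_eval t \; ct_eval u)%relation
  end.

Fixpoint ct_over (G : set (set (X * X))) t : Prop :=
  match t with
  | CTdiag => True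
  | CTgen E => G E
  | CTinv t => ct_over G t
  | CTunion t u | CTcomp t u => ct_over G t /\ ct_over G u
  end.

(** A term is coded recursively as a pair of a tag and an argument, by an injection from the square
    of [K] to [K]; induction on terms shows that the code is injective. *)
Lemma ct_over_card_le (G : set (set (X * X))) U (K : set U) :
  infinite_set K -> G #<= K -> ct_over G #<= K.
Proof.
move=> Kinf GK; have [k0 Kk0] := infinite_setN0 Kinf.
have Kne : K !=set0 by exists k0.
have [i [+ iinj]] := card_le_elim Kne (iffLR (infiniteP K) Kinf).
move=> /(_ _ I) iK; have {}iinj : injective i by move=> m n; exact: iinj.
have Kne2 : K `*` K !=set0 by exists (k0, k0).
have [j [jK jinj]] := card_le_elim Kne (square_card_le Kinf).
have [g [gK ginj]] := card_le_elim Kne GK.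
have {}jK a b : K a -> K b -> K (j (a, b)) by move=> Ka Kb; exact: jK.
have jP a b a' b' : K a -> K b -> K a' -> K b' -> j (a, b) = j (a', b') ->
    a = a' /\ b = b'.
  move=> Ka Kb Ka' Kb' e.
  by have [] := jinj (a, b) (a', b') (conj Ka Kb) (conj Ka' Kb') e.
pose tag (t : coarse_term (set (X * X))) := match t with
  | CTdiag => 0%N | CTgen _ => 1%N | CTinv _ => 2%N
  | CTunion _ _ => 3%N | CTcomp _ _ => 4%N end.
(* The coding function is a parameter of [arg], so that the equation [cE] follows by cases on the
   term. The diagonal has no argument and [k0] fills its slot. *)
pose arg c (t : coarse_term (set (X * X))) : U := match t with
  | CTdiag => k0
  | CTgen E => g E
  | CTinv t => c t
  | CTunion t u | CTcomp t u => j (c t, c u)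
  end.
pose c := fix c t := j (i (tag t), arg c t).
have cE t : c t = j (i (tag t), arg c t) by case: t.
have cK t : ct_over G t -> K (c t) /\ K (arg c t).
  suff h : ct_over G t -> K (arg c t).
    move=> /h Kt; split=> //; rewrite cE.
    exact: (jK _ _ (iK _) Kt).
  have cP u : K (arg c u) -> K (c u).
    by move=> Ku; rewrite cE; exact: (jK _ _ (iK _) Ku).
  elim: t => //= [t ih h|t iht u ihu [ht hu]|t iht u ihu [ht hu]].
  - exact/cP/ih.
  - by apply: jK; [exact/cP/iht|exact/cP/ihu].
  - by apply: jK; [exact/cP/iht|exact/cP/ihu].
apply: (@card_le_intro _ _ _ _ c) => [t /cK[]//|].
have eqc t t' : ct_over G t -> ct_over G t' -> c t = c t' ->
    tag t = tag t' /\ arg c t = arg c t'.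
  move=> /cK[_ Kt] /cK[_ Kt']; rewrite !cE => /jP[]// /iinj.
  by [].
elim=> [|E|t ih|t iht u ihu|t iht u ihu] [|E'|t'|t' u'|t' u'] h h'
  /(eqc _ _ h h')[//= _].
- by move=> /ginj->.
- by move=> /ih->.
- move: h h' => [? ?] [? ?] /jP[].
  1-4: exact: (proj1 (cK _ _)).
  by move=> /iht-> // /ihu->.
- move: h h' => [? ?] [? ?] /jP[].
  1-4: exact: (proj1 (cK _ _)).
  by move=> /iht-> // /ihu->.
Qed.

(** The family consists of the values of the terms over [G]. The sets below such values form a
    coarse structure containing [G], so the minimality of [EE] makes the family cofinal. *)
Lemma coarse_cofinal (EE G : set (set (X * X))) U (K : set U) :
    coarse_structure EE -> generates EE G -> infinite_set K -> G #<= K ->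
  exists D, [/\ D `<=` EE, D #<= K &
    forall E, EE E -> exists2 E', D E' & E `<=` E'].
Proof.
move=> csE gen Kinf GK; exists (ct_eval @` ct_over G); split.
- have GE : G `<=` EE by rewrite -gen => E GE; exact: sub_gen_smallest.
  case: csE => diag sub inv union comp _ [t + <-].
  elim: t => //= [t ih h|t iht u ihu [ht hu]|t iht u ihu [ht hu]].
  - exact/inv/ih.
  - by apply: union; [exact: iht|exact: ihu].
  - by apply: comp; [exact: iht|exact: ihu].
- exact: card_le_trans (card_image_le _ _) (ct_over_card_le Kinf GK).
move=> E; rewrite -gen =>
  /(_ [set E | exists2 E', (ct_eval @` ct_over G) E' & E `<=` E']).
apply; split; last first.
  by move=> F GF; exists F => //; exists (CTgen F).
split.
- by eexists; first by exists CTdiag.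
- by move=> A B BA [C DC AC]; exists C => //; exact: (subset_trans BA).
- move=> A [_ [t tG <-] At]; eexists; first by exists (CTinv t).
  by move=> [x y] /At.
- move=> A B [_ [t tG <-] At] [_ [u uG <-] Bu].
  by exists (ct_eval (CTunion t u)); [exists (CTunion t u)|exact: setUSS].
- move=> A B [_ [t tG <-] At] [_ [u uG <-] Bu].
  eexists; first by exists (CTcomp t u).
  exact: set_compose_subset.
Qed.

End CoarseTerms.

Lemma prod_nat_card_le X Y : infinite_set [set: X] ->
  [set: Y] #<= [set: X * nat] -> [set: Y] #<= [set: X].
Proof.
move=> Xinf /card_le_trans; apply; apply: card_le_trans (square_card_le Xinf).
have [x0 _] := infinite_setN0 Xinf.
have [i [_ iinj]] := card_le_elim (ex_intro _ x0 I) (iffLR (infiniteP _) Xinf).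
apply: (@card_le_intro _ _ _ _ (fun p => (p.1, i p.2))) => // -[x m] [y n] _ _ /=.
by case=> -> /iinj ->.
Qed.

(** * Baire category in polydisks *)

(** Nested nonempty open sets are chosen, by regularity, so that the closure of the next one avoids
    [N n]; compactness gives a point common to all the closures. *)
Lemma baire_compact (T : topologicalType) (N : nat -> set T) :
    compact [set: T] -> regular_space T -> (forall n, nowhere_dense (N n)) ->
  [set: T] !=set0 -> \bigcup_n N n <> setT.
Proof.
move=> cT rT nd [t0 _] cov.
have step (n : nat) (U : set T) : open U -> U !=set0 ->
    exists V : set T,
      [/\ open V, V !=set0, closure V `<=` U & closure V `&` N n = set0].
  move=> oU [u Uu].
  have [v [Uv nNv]] : exists v, U v /\ ~ closure (N n) v.
    apply: contrapT => h; have := nd n; apply/eqP/set0P; exists u.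
    have : nbhs u U by exact: open_nbhs_nbhs.
    by apply: filterS => v Uv; apply: contrapT => nv; apply: h; exists v.
  have oW : open (U `&` ~` closure (N n)).
    by apply: openI => //; apply: closed_openC; exact: closed_closure.
  have /rT[V nV clV] : nbhs v (U `&` ~` closure (N n)) by exact: open_nbhs_nbhs.
  exists (interior V); split.
  - exact: open_interior.
  - by exists v; exact: nV.
  - by move=> w Vw; have [] := clV w (closureS (@interior_subset _ V) Vw).
  - apply/seteqP; split=> // w [/(closureS (@interior_subset _ V))/clV[_ nw] Nw].
    by apply: nw; exact: subset_closure.
have /choice[f fP] : forall p : nat * set T, exists V, open p.2 -> p.2 !=set0 ->
    [/\ open V, V !=set0, closure V `<=` p.2 & closure V `&` N p.1 = set0].
  move=> [n U]; have [[oU U0]|h] := pselect (open U /\ U !=set0).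
    by have [V VP] := step n U oU U0; exists V.
  by exists set0 => oU U0; case: h.
pose V := fix V n := match n with 0%N => setT | m.+1 => f (m, V m) end.
have VP n : open (V n) /\ V n !=set0.
  elim: n => [|n [ih1 ih2]]; first by split; [exact: openT|exists t0].
  by have [] := fP (n, V n) ih1 ih2.
have Vs n : closure (V n.+1) `<=` V n.
  by have [oV n0] := VP n; have [] := fP (n, V n) oV n0.
have VN n : closure (V n.+1) `&` N n = set0.
  by have [oV n0] := VP n; have [] := fP (n, V n) oV n0.
have Vd m n : (m <= n)%N -> V n `<=` V m.
  move=> /subnK <-; elim: (n - m)%N => [//|k ih] w.
  by rewrite addSn => /subset_closure/Vs/ih.
have FF : ProperFilter (filter_from setT V).
  apply: filter_from_proper; last by move=> n _; exact: (VP n).2.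
  apply: filter_from_filter; first by exists 0%N.
  move=> m n _ _; exists (maxn m n) => // w Vw; split; apply: Vd Vw.
    exact: leq_maxl.
  exact: leq_maxr.
have [x [_ clx]] := cT _ FF filterT.
have xV n : closure (V n) x by move=> B nB; apply: clx => //; exists n.
have [n _ Nx] : (\bigcup_n N n) x by rewrite cov.
have : (closure (V n.+1) `&` N n) x by split.
by rewrite VN.
Qed.

Lemma compact_set_type (T : topologicalType) (A : set T) :
  compact A -> compact [set: set_type A].
Proof.
move=> cA F FF _.
have [|z [Az clz]] := cA (val @ F) _.
  by apply: (@filterS _ F _ setT) filterT => x _; exact: set_valP.
exists (SigSub (mem_set Az)); split=> // B C FB.
move=> [_ [[W oW <-] /= Wz] WC].
have [] := clz (val @` B) W.
- by apply: (@filterS _ F _ B) FB => x Bx; exists x.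
- exact: open_nbhs_nbhs.
by move=> _ [[x Bx <-] Wx]; exists x; split=> //; exact: WC.
Qed.

Lemma finite_powersetT (T : choiceType) :
  finite_set [set: T] -> finite_set [set: set T].
Proof.
move=> finT.
have fP := finite_image (fun B : {fset T} => [set` B])
  (finite_fset (fpowerset (fset_set [set: T]))).
apply: sub_finite_set fP => B _; exists (fset_set B); last first.
  by rewrite fset_setK //; exact: sub_finite_set finT.
rewrite /= fpowersetE; apply/fsubsetP => x _.
by rewrite in_fset_set // inE.
Qed.

(** Over the neighbourhoods of a limit point [t], the fibres of [P] generate a proper filter on [U];
    if [u] is a cluster point of it, then [(t, u)] lies in the closure of [P]. *)
Lemma closed_proj_compact (T U : topologicalType) (P : set (T * U)) :
  compact [set: U] -> closed P -> closed [set t | exists u, P (t, u)].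
Proof.
move=> cU cP t clt.
pose F : set_system U := filter_from (nbhs t)
  (fun V => [set u | exists2 t', V t' & P (t', u)]).
have FF : ProperFilter F.
  apply: filter_from_proper => [|V /clt[t' [[u Pu] Vt']]]; last by exists u, t'.
  apply: filter_from_filter; first by exists setT; exact: filterT.
  move=> V W nV nW; exists (V `&` W); first exact: filterI.
  by move=> u [t' [Vt' Wt'] Pu]; split; exists t'.
have [u [_ clu]] := cU F FF filterT.
exists u; apply: cP => A [[V W] /= [nV nW] VWA].
have [||u' [[t' Vt' Pu'] Wu']] := clu [set u | exists2 t', V t' & P (t', u)] W.
- by exists V.
- by [].
by exists (t', u'); split=> //; exact: VWA.
Qed.

(** * Topology of polydisks, and what smallness yields there *)

Section Polydisk.
Variable R : realType.
Local Notation C := R[i]^o.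
Local Notation disk := (set_type (@cdisk R)).
Local Notation polydisk J := {ptws J -> disk}.

Lemma norm_normc (z : R[i]) : `|z| = (normc z)%:C.
Proof. by []. Qed.

(** The norm that defines the topology of [C] is complex valued; this passes to the real valued
    modulus [normc]. *)
Lemma nbhs_normcP (z : C) (A : set C) :
  nbhs z A <-> exists2 e : R, 0 < e & forall w, normc (z - w) < e -> A w.
Proof.
split=> [/nbhs_normP[e e0 eA]|[e e0 eA]].
  have [r [re r0]] : exists r : R, e = r%:C /\ 0 < r.
    move: e0 => /=; case: e {eA} => a b; rewrite ltcE /= => /andP[/eqP -> a0].
    by exists a.
  exists r => // w zw; apply: eA; rewrite /= norm_normc re ltcR //.
have h : filter_from [set x : R[i] | 0 < x] (ball_ (fun x => `|x|) z) A.
  exists e%:C => /=; first by rewrite ltcR.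
  by move=> w /=; rewrite norm_normc ltcR => /eA.
exact: (@nbhs_norm_le_nbhs _ C z A h).
Qed.

Lemma cdiskP (z : R[i]) : cdisk z <-> normc z <= 1.
Proof. by rewrite /cdisk /= norm_normc -[1]/(1%:C) lecR. Qed.

Lemma disk_normc (z : disk) : normc (val z : C) <= 1.
Proof. by apply/cdiskP; exact: set_valP. Qed.

Lemma normc_ge0 (z : R[i]) : 0 <= normc z.
Proof. by case: z => a b; exact: sqrtr_ge0. Qed.

Lemma normc_le_ReIm (a b : R) : normc (a +i* b)%C <= `|a| + `|b|.
Proof.
rewrite /= -(ler_sqr (sqrtr_ge0 _)) ?nnegrE ?addr_ge0 //.
rewrite sqr_sqrtr ?addr_ge0 ?sqr_ge0 //.
rewrite sqrrD !real_normK ?num_real // -addrA lerD2l addrC lerDl.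
by rewrite mulrn_wge0 // mulr_ge0.
Qed.

Lemma Re_le_normc (a b : R) : `|a| <= normc (a +i* b)%C.
Proof. by rewrite /= -sqrtr_sqr ler_wsqrtr // lerDl sqr_ge0. Qed.

Lemma Im_le_normc (a b : R) : `|b| <= normc (a +i* b)%C.
Proof. by rewrite /= -sqrtr_sqr ler_wsqrtr // lerDr sqr_ge0. Qed.

(** The disk is closed in the continuous image of a compact real square. *)
Lemma disk_compact : compact [set: disk].
Proof.
apply: compact_set_type.
pose f (v : 'rV[R]_2) : C := (v 0 0 +i* v 0 1)%C.
have fc : continuous f.
  move=> v A /nbhs_normcP[e e0 eA].
  suff h : nbhs v (f @^-1` A) by exact: h.
  have nbi i : nbhs v [set w : 'rV[R]_2 | `|(v : 'rV[R]_2) 0 i - w 0 i| < e / 2].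
    have := @coord_continuous _ 1 2 0 i v.
    by move=> /cvgrPdist_lt/(_ (e / 2)); apply; rewrite divr_gt0.
  apply: filterS2 (nbi 0) (nbi 1) => w /= w0 w1.
  apply: eA; rewrite /f; apply: le_lt_trans (normc_le_ReIm _ _) _.
  by rewrite [e]splitr; exact: ltrD.
pose K : set 'rV[R]_2 := [set v | forall i, `[-1, 1]%classic (v ord0 i)].
have cK : compact (f @` K).
  apply: continuous_compact; first exact: continuous_subspaceT.
  by apply: (@rV_compact R 2 (fun=> `[-1, 1]%classic)) => i; exact: segment_compact.
apply: (subclosed_compact _ cK).
  move=> z cz; apply/cdiskP; rewrite leNgt; apply/negP => z1.
  have [|w [/cdiskP w1]] := cz [set w | normc (z - w) < normc z - 1].
    by apply/nbhs_normcP; exists (normc z - 1); rewrite ?subr_gt0.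
  move=> /= zw; have := le_normcD (z - w) w; rewrite subrK.
  by apply/negP; rewrite -ltNge; lra.
move=> [a b] /cdiskP z1; exists (\row_i (if i == 0 then a else b)).
  move=> i; rewrite mxE /= in_itv /= -ler_norml.
  by case: ifP => _; apply: le_trans z1; [exact: Re_le_normc|exact: Im_le_normc].
by rewrite /f !mxE.
Qed.

Lemma polydisk_regular (J : Type) : regular_space (polydisk J).
Proof. exact: uniform_regular. Qed.

Lemma polydisk_compact (J : choiceType) : compact [set: polydisk J].
Proof.
have := @tychonoff J (fun=> disk) (fun=> setT) (fun=> disk_compact).
by congr compact; apply/seteqP; split.
Qed.

Lemma coord_nbhs (J : eqType) (l : polydisk J) (j : J) (e : R) : 0 < e ->
  nbhs l [set m : polydisk J | normc (val (l j) - val (m j) : C) < e].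
Proof.
move=> e0.
have vc : continuous (val : disk -> C) by exact: initial_continuous.
have hW : nbhs (val (l j) : C) [set w | normc (val (l j) - w : C) < e].
  by apply/nbhs_normcP; exists e.
exact: (@proj_continuous J (fun=> disk) j l _ (vc (l j) _ hW)).
Qed.

(** The sets [U] that satisfy the conclusion form a filter. It converges to [l] in each coordinate,
    hence in the product, so it contains every neighbourhood of [l]. *)
Lemma polydisk_nbhs_finite (J : Type) (l : polydisk J) (U : set (polydisk J)) :
  nbhs l U -> exists2 S : set J, finite_set S &
    forall m : polydisk J, (forall j, S j -> m j = l j) -> U m.
Proof.
pose G : set_system (polydisk J) := [set U | exists2 S : set J, finite_set S &
    forall m : polydisk J, (forall j, S j -> m j = l j) -> U m].
suff : G --> l by exact.
have FG : Filter G.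
  split.
  - by exists set0.
  - move=> A B [S fS SA] [S' fS' SB]; exists (S `|` S').
      by rewrite finite_setU.
    by move=> m ml; split; [apply: SA|apply: SB] => j Sj; apply: ml; [left|right].
  - by move=> A B AB [S fS SA]; exists S => // m /SA/AB.
apply/cvg_sup => j A [_ [[W oW <-] /= Wl] WA].
exists [set j] => // m /(_ j erefl) mj.
by apply: WA; rewrite /= mj.
Qed.

(** Coordinates are copied along the partial map [g] and the others are filled in from [c]. Both the
    restriction along an injection and its sections have this form. *)
Definition polydisk_reindex J K (g : K -> option J) (c : polydisk K)
  (l : polydisk J) : polydisk K := fun k => if g k is Some j then l j else c k.

Lemma polydisk_reindex_continuous (J K : choiceType) (g : K -> option J)
    (c : polydisk K) : continuous (polydisk_reindex g c).
Proof.
move=> l; have nF : Filter (nbhs l) by exact: nbhs_filter.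
have FF : Filter (polydisk_reindex g c @ l).
  by apply: fmap_filter; exact: nbhs_filter.
apply/cvg_sup => k A [_ [[W oW <-] /= Wl] WA].
suff h : nbhs l (polydisk_reindex g c @^-1` A) by exact: h.
have [[j gk]|gk] : (exists j, g k = Some j) \/ g k = None.
- by case: (g k) => [j|]; [left; exists j|right].
- have nW : nbhs (l j) W.
    by apply: open_nbhs_nbhs; split=> //; move: Wl; rewrite /polydisk_reindex gk.
  have h : nbhs l (proj j @^-1` W).
    exact: (@proj_continuous J (fun=> disk) j l _ nW).
  apply: filterS h => m Wm.
  by apply: WA; rewrite /= /polydisk_reindex gk.
- apply: (@filterS _ (nbhs l) _ setT); last exact: filterT.
  by move=> m _; apply: WA; move: Wl; rewrite /= /polydisk_reindex gk.
Qed.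

Lemma cdisk0 : @cdisk R 0.
Proof. by apply/cdiskP; rewrite normc0. Qed.

Definition disk0 : disk := SigSub (mem_set cdisk0).

Lemma closed_nowhere_dense (T : topologicalType) (A : set T) : closed A ->
  (forall x : T, ~ nbhs x A) -> nowhere_dense A.
Proof.
move=> cA nA; rewrite /nowhere_dense -(closure_id _).1 //.
by apply/seteqP; split=> // x /nA.
Qed.

(** Otherwise the sets [A E], for [E] in a cofinal family, form a nowhere dense cover. For finite
    [G] the family can be countable, which contradicts Baire's theorem; for infinite [G] it can be
    no larger than [G], and pulling the cover back to the polydisk over [X] contradicts
    smallness. *)
Lemma small_category (X Y : choiceType) (EE : set (set (X * X)))
    (A : set (X * X) -> set (polydisk Y)) :
    coarse_structure EE -> small R EE -> [set: Y] #<= [set: X * nat] ->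
    (forall E F, E `<=` F -> A E `<=` A F) ->
    (forall E, EE E -> closed (A E)) ->
    (forall l, exists2 E, EE E & A E l) ->
  exists2 E, EE E & exists l : polydisk Y, nbhs l (A E).
Proof.
move=> csE smallX YX Amono Acl Acov; apply: contrapT => noE.
have {noE} Ant E (l : polydisk Y) : EE E -> ~ nbhs l (A E).
  by move=> EEE nlE; apply: noE; exists E => //; exists l.
have [|G leastG] := @least_card_exists _ (generates EE).
  exists EE; rewrite /generates; apply/seteqP; split=> [E|E]; last first.
    exact: sub_gen_smallest.
  by move/(_ EE); apply; split.
have genG : generates EE G by case: leastG.
have [Gfin|Ginf] := pselect (finite_set G).
  have [D [DE Dc Dcof]] := coarse_cofinal csE genG infinite_nat
    (finite_set_countable Gfin).
  have [f [_ finj]] := card_le_elim (ex_intro _ 0%N I) Dc.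
  (* As [f] is injective on [D], the union has at most one member: [N n] is some [A E] or empty. *)
  pose N n := \bigcup_(E in [set E | D E /\ f E = n]) A E.
  apply: (@baire_compact (polydisk Y) N).
  - exact: polydisk_compact.
  - exact: polydisk_regular.
  - move=> n; have [[E [DE' fE]]|h] := pselect (exists E, D E /\ f E = n); last first.
      rewrite /N (_ : [set _ | _] = set0) ?bigcup_set0; last first.
        by apply/seteqP; split=> // E hE; case: h; exists E.
      by apply: closed_nowhere_dense => [|x /nbhs_singleton//]; exact: closed0.
    rewrite /N (_ : [set _ | _] = [set E]) ?bigcup_set1; last first.
      apply/seteqP; split=> [F [DF fF]|_ -> //].
      by apply: finj => //; rewrite fF.
    by apply: closed_nowhere_dense => [|x]; [exact/Acl/DE|exact/Ant/DE].
  - by exists (fun=> disk0).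
  apply/seteqP; split=> // l _; have [E EEE AEl] := Acov l.
  have [E' DE' EE'] := Dcof E EEE.
  by exists (f E') => //; exists E' => //; exact: Amono EE' _ AEl.
(* A finite [X] has only finitely many sets of pairs, hence no infinite [G]. *)
have Xinf : infinite_set [set: X].
  move=> Xfin; apply: Ginf; apply: sub_finite_set (@subsetT _ _) _.
  by apply: finite_powersetT; rewrite -setXTT; exact: finite_setX.
have [x0 _] := infinite_setN0 Xinf.
have [g [_ ginj]] := card_le_elim (ex_intro _ x0 I) (prod_nat_card_le Xinf YX).
have {}ginj y y' : g y = g y' -> y = y' by exact: ginj.
have [D [DE Dc Dcof]] := coarse_cofinal csE genG Ginf (card_lexx G).
pose h : polydisk X -> polydisk Y :=
  polydisk_reindex (fun y => Some (g y)) (fun=> disk0).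
have hc : continuous h by exact: polydisk_reindex_continuous.
pose N := [set h @^-1` A E | E in D].
have Ncov : nowhere_dense_cover N.
  split=> [_ [E DE' <-]|].
    apply: closed_nowhere_dense => [|l nl].
      by apply: closed_comp; [move=> l _; exact: hc|exact/Acl/DE].
    (* [k] inverts [g] on its range. The continuous map [s] built from it is a section of [h]
       through [l], so an interior point of the preimage yields one of [A E]. *)
    have /choice[k kP] : forall x, exists o : option Y, forall y,
        o = Some y <-> g y = x.
      move=> x; have [[y yx]|nx] := pselect (exists y, g y = x).
        exists (Some y) => z; split=> [[<-]|zx] //; congr Some.
        by apply: ginj; rewrite zx.
      by exists None => z; split=> // zx; case: nx; exists z.
    have kg y : k (g y) = Some y by apply/kP.
    pose s := polydisk_reindex k l.
    have sh : s (h l) = l.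
      apply: funext => x; rewrite /s /h /polydisk_reindex.
      by case kx: (k x) => [y|//]; move/kP: kx => ->.
    have hs m : h (s m) = m.
      by apply: funext => y; rewrite /s /h /polydisk_reindex kg.
    apply: (Ant E (h l) (DE _ DE')).
    have sc : continuous s by exact: polydisk_reindex_continuous.
    have nsl : nbhs (s (h l)) (h @^-1` A E) by rewrite sh.
    have : nbhs (h l) (s @^-1` (h @^-1` A E)) by exact: (sc (h l) _ nsl).
    by apply: filterS => m /=; rewrite hs.
  apply/seteqP; split=> // l _; have [E EEE AEl] := Acov (h l).
  have [E' DE' EE'] := Dcof E EEE.
  by exists (h @^-1` A E'); [exists E'|exact: Amono EE' _ AEl].
have [|N0 leastN] := @least_card_exists _ (@nowhere_dense_cover R X).
  by exists N.
have [_] := smallX G N0 leastG leastN; apply.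
apply: card_le_trans (leastN.2 _ Ncov) _.
exact: card_le_trans (card_image_le _ _) Dc.
Qed.

End Polydisk.

(** * The norm and inner product of l2 *)

Section Ell2Norm.
Variables (R : realType) (X : choiceType).
Local Notation C := R[i]^o.
Implicit Types (u v : ell2 R X) (A : {fset X}).

Definition sqsum (f : X -> C) A : R := \sum_(x <- A) normc (f x) ^+ 2.

Lemma esum_sqsum_le (f : X -> C) (M : R) :
  (\esum_(x in setT) (normc (f x) ^+ 2)%:E <= M%:E)%E <->
  forall A, sqsum f A <= M.
Proof.
have sumE (A : {fset X}) :
    (\sum_(x \in [set` A]) (normc (f x) ^+ 2)%:E = (sqsum f A)%:E)%E.
  by rewrite fsbig_finite ?set_fsetK ?sumEFin //; exact: finite_fset.
split=> [le A|le].
  rewrite -lee_fin -sumE; apply: le_trans le; apply: ereal_sup_ubound.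
  by exists [set` A] => //; split=> //; exact: finite_fset.
apply: ge_ereal_sup => _ [F [finF _] <-].
by rewrite -(fset_setK finF) sumE lee_fin.
Qed.

Lemma ell2_predP (f : X -> C) (M : R) :
  (forall A, sqsum f A <= M) -> f \in @ell2_pred R X.
Proof.
move=> le; rewrite inE /= /summable.
under eq_esum do rewrite gee0_abs ?lee_fin ?sqr_ge0 //.
by apply: le_lt_trans (iffRL (esum_sqsum_le f M) le) _; rewrite ltry.
Qed.

Lemma esum_ell2 u :
  (\esum_(x in setT) (normc (u x) ^+ 2)%:E = (ell2_norm u ^+ 2)%:E)%E.
Proof.
have := valP u; rewrite inE /= /summable.
under eq_esum do rewrite gee0_abs ?lee_fin ?sqr_ge0 //.
move=> fin; have ge0 : (0 <= \esum_(x in setT) (normc (u x) ^+ 2)%:E)%E.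
  by apply: esum_ge0 => x _; rewrite lee_fin sqr_ge0.
rewrite /ell2_norm sqr_sqrtr ?fine_ge0 // fineK //.
by rewrite ge0_fin_numE.
Qed.

Lemma ell2_norm_ge0 u : 0 <= ell2_norm u.
Proof. exact: sqrtr_ge0. Qed.

Lemma ell2_normP u (M : R) : 0 <= M ->
  ell2_norm u <= M <-> forall A, sqsum u A <= M ^+ 2.
Proof.
move=> M0; rewrite -esum_sqsum_le esum_ell2 lee_fin ler_sqr //.
by rewrite nnegrE ell2_norm_ge0.
Qed.

Lemma sqsum_le_norm u A : sqsum u A <= ell2_norm u ^+ 2.
Proof. by have /ell2_normP := lexx (ell2_norm u); apply; exact: ell2_norm_ge0. Qed.

Lemma sqsum_approx u (e : R) : 0 < e ->
  exists A, ell2_norm u ^+ 2 - e < sqsum u A.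
Proof.
move=> e0; apply: contrapT => h.
have := esum_sqsum_le u (ell2_norm u ^+ 2 - e); rewrite esum_ell2 lee_fin => -[_].
rewrite leNgt gtrBl e0 => h'; apply: (Bool.diff_false_true); apply: h' => A.
by rewrite leNgt; apply/negP => lt; apply: h; exists A.
Qed.

Lemma sqsumS f A B : (A `<=` B)%fset -> sqsum f A <= sqsum f B.
Proof.
move=> AB; rewrite /sqsum (big_fsetID _ (mem A) B) /=.
have -> : [fset x | x in B & x \in A]%fset = A.
  apply/fsetP => x; rewrite !inE /=; have /fsubsetP/(_ x) := AB.
  by case: (x \in A) => [->|]; rewrite ?andbF ?andbT.
by rewrite lerDl sumr_ge0 // => x _; exact: sqr_ge0.
Qed.

Lemma normc_le_norm u x : normc (u x) <= ell2_norm u.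
Proof.
rewrite -(ler_sqr (normc_ge0 _)) ?nnegrE ?ell2_norm_ge0 //.
by have := sqsum_le_norm u [fset x]%fset; rewrite /sqsum big_seq_fset1.
Qed.

Lemma ell2_ext u v : (forall x, u x = v x) -> u = v.
Proof. by move=> uv; apply: val_inj; apply: funext. Qed.

Lemma ell2_norm0 : ell2_norm (0 : ell2 R X) = 0.
Proof.
apply/le_anti; rewrite ell2_norm_ge0 andbT; apply/ell2_normP => // A.
by rewrite /sqsum big1 // => x _; rewrite normc0 expr0n.
Qed.

Lemma ell2_norm_eq0 u : ell2_norm u = 0 -> u = 0.
Proof.
move=> u0; apply: ell2_ext => x; apply: eq0_normc; apply/le_anti.
by rewrite normc_ge0 andbT -u0 normc_le_norm.
Qed.

(** The upper bound holds coordinatewise; applied to [a^-1] and [a *: u], it gives the lower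
    bound. *)
Lemma ell2_normZ (a : R[i]) u : ell2_norm (a *: u) = normc a * ell2_norm u.
Proof.
have le b v : ell2_norm (b *: v) <= normc b * ell2_norm v.
  apply/ell2_normP; first by rewrite mulr_ge0 ?normc_ge0 ?ell2_norm_ge0.
  move=> A; rewrite /sqsum exprMn.
  rewrite (eq_bigr (fun x => normc b ^+ 2 * normc (v x) ^+ 2)); last first.
    by move=> x _; rewrite -exprMn -normcM.
  by rewrite -mulr_sumr ler_wpM2l ?sqr_ge0 // sqsum_le_norm.
apply/le_anti; rewrite le //=.
have [->|a0] := eqVneq a 0; first by rewrite normc0 mul0r ell2_norm_ge0.
have na0 : 0 < normc a.
  by rewrite lt0r normc_ge0 andbT; apply: contra_neq a0 => /eq0_normc.
rewrite -ler_pdivlMl //; have := le a^-1 (a *: u).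
by rewrite scalerA mulVf // scale1r normcV.
Qed.

(** A weighted form of [2pq <= p^2 + q^2]. With [s] and [t] the norms of two vectors, the weights
    sum up to exactly [(s + t) ^+ 2], which proves the triangle inequality without
    Cauchy-Schwarz. *)
Lemma sqr_normcD_le (a b : R[i]) (s t : R) : 0 < s -> 0 < t ->
  normc (a + b) ^+ 2 <= (1 + t / s) * normc a ^+ 2 + (1 + s / t) * normc b ^+ 2.
Proof.
move=> s0 t0; apply: (@le_trans _ _ ((normc a + normc b) ^+ 2)).
  by rewrite ler_sqr ?nnegrE ?normc_ge0 ?addr_ge0 ?normc_ge0 // le_normcD.
set p := normc a; set q := normc b.
have : 0 <= (t * p - s * q) ^+ 2 / (s * t) by rewrite divr_ge0 ?sqr_ge0 ?mulr_ge0 ?ltW.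
rewrite [X in 0 <= X -> _](_ : _ = t / s * p ^+ 2 + s / t * q ^+ 2 - p * q *+ 2).
  rewrite sqrrD; lra.
by field; rewrite !gt_eqF.
Qed.

Lemma ell2_normD u v : ell2_norm (u + v) <= ell2_norm u + ell2_norm v.
Proof.
have [/ell2_norm_eq0 ->|u0] := eqVneq (ell2_norm u) 0.
  by rewrite ell2_norm0 !add0r.
have [/ell2_norm_eq0 ->|v0] := eqVneq (ell2_norm v) 0.
  by rewrite ell2_norm0 !addr0.
have {}u0 : 0 < ell2_norm u by rewrite lt0r u0 ell2_norm_ge0.
have {}v0 : 0 < ell2_norm v by rewrite lt0r v0 ell2_norm_ge0.
have su := sqsum_le_norm u; have sv := sqsum_le_norm v.
move: (ell2_norm u) (ell2_norm v) u0 v0 su sv => s t s0 t0 su sv.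
apply/ell2_normP => [|A]; first by rewrite addr_ge0 ?ltW.
apply: (@le_trans _ _ ((1 + t / s) * sqsum u A + (1 + s / t) * sqsum v A)).
  rewrite /sqsum !mulr_sumr -big_split /=; apply: ler_sum => x _.
  exact: sqr_normcD_le.
apply: (@le_trans _ _ ((1 + t / s) * s ^+ 2 + (1 + s / t) * t ^+ 2)).
  have c0 a b : 0 < a -> 0 < b -> 0 <= 1 + a / b :> R.
    by move=> a0 b0; rewrite addr_ge0 ?divr_ge0 // ltW.
  by apply: lerD; apply: ler_wpM2l => //; exact: c0.
by rewrite le_eqVlt; apply/orP; left; apply/eqP; field; rewrite !gt_eqF.
Qed.

Lemma ell2_normN u : ell2_norm (- u) = ell2_norm u.
Proof. by rewrite -scaleN1r ell2_normZ normcN normc1 mul1r. Qed.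

Lemma ell2D u v x : (u + v) x = u x + v x. Proof. by []. Qed.
Lemma ell2N u x : (- u) x = - u x. Proof. by []. Qed.
Lemma ell2Z (a : R[i]) u x : (a *: u) x = a * u x. Proof. by []. Qed.
Lemma ell2_sumE I (r : seq I) (P : pred I) (F : I -> ell2 R X) x :
  (\sum_(i <- r | P i) F i) x = \sum_(i <- r | P i) F i x.
Proof. by elim/big_rec2: _ => // i a b _ <-. Qed.

Lemma deltaE (x y : X) : delta R x y = (y == x)%:R. Proof. by []. Qed.

(** Written as a combination of basis vectors, so that linear operators apply term by term. *)
Definition trunc A u : ell2 R X := \sum_(x <- A) u x *: delta R x.

Lemma truncE A u x : trunc A u x = if x \in A then u x else 0.
Proof.
have -> : trunc A u x = \sum_(y <- A) u y * (x == y)%:R by rewrite ell2_sumE.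
case: ifPn => xA.
  rewrite (big_fsetD1 x) //= eqxx mulr1 big_seq big1 ?addr0 // => y.
  by rewrite !inE => /andP[yx _]; rewrite eq_sym (negPf yx) mulr0.
rewrite big_seq big1 // => y yA.
by case: eqP => [xy|]; rewrite ?mulr0 //; move: xA; rewrite xy yA.
Qed.

(** The sum of squares over the union of [A] and [B] is that of [u] over [A] plus that of the
    remainder over [B]; if the first is close to the total, the second is small. *)
Lemma trunc_approx u (e : R) : 0 < e -> exists A, ell2_norm (u - trunc A u) <= e.
Proof.
move=> e0; have [A Au] := sqsum_approx u (exprn_gt0 2 e0); exists A.
apply/ell2_normP => [|B]; first exact: ltW.
have := sqsum_le_norm u (A `|` B)%fset.
have -> : sqsum u (A `|` B)%fset = sqsum u A + sqsum (u - trunc A u) B.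
  have AE : [fset x | x in (A `|` B)%fset & x \in A]%fset = A.
    by apply/fsetP => x; rewrite !inE /=; case: (x \in A); rewrite ?andbF.
  have BE : [fset x | x in (A `|` B)%fset & x \notin A]%fset =
      [fset x | x in B & x \notin A]%fset.
    by apply/fsetP => x; rewrite !inE /=; case: (x \in A); rewrite ?andbF.
  rewrite -[sqsum (_ - _) B]/(sqsum (fun x => u x - trunc A u x) B).
  rewrite /sqsum (big_fsetID _ (mem A) (A `|` B)%fset) /= AE BE; congr (_ + _).
  rewrite [RHS](big_fsetID _ (mem A) B) /= [X in _ = X + _]big1_seq ?add0r.
    rewrite !big_seq; apply: eq_bigr => x; rewrite !inE /= => /andP[_ xA].
    by rewrite truncE (negPf xA) subr0.
  move=> x /=; rewrite !inE /= => /andP[_ xA].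
  by rewrite truncE xA subrr normc0 expr0n.
by move: Au; lra.
Qed.

End Ell2Norm.

Section Inner.
Variables (R : realType) (X : choiceType).
Local Notation C := R[i]^o.
Implicit Types (u v : ell2 R X) (A B : {fset X}).

Lemma summability_sumP (f : X -> C) (l : C) :
  (forall e : R, 0 < e -> exists A, forall B, (A `<=` B)%fset ->
     normc (l - \sum_(x <- B) f x) < e) -> summability.sum f = l.
Proof.
have tf : ProperFilter (@summability.totally X).
  exact: summability.totally_filter.
move=> fl; apply: (cvg_lim (@norm_hausdorff _ C)) => W /nbhs_normcP[e e0 eW].
have [A Al] := fl e e0; exists A => // B /= AB.
by apply: eW; have := Al B AB; rewrite big_seq_fsetE.
Qed.

Lemma summability_sum_finsupp (f : X -> C) A :
  (forall x, x \notin A -> f x = 0) -> summability.sum f = \sum_(x <- A) f x.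
Proof.
move=> fA; apply: summability_sumP => e e0; exists A => B AB.
rewrite -(big_fset_incl _ AB) ?subrr ?normc0 // => x _ xA; exact: fA.
Qed.

Lemma conj_delta (x y : X) : (delta R x y : R[i])^*%R = (y == x)%:R.
Proof. by rewrite deltaE; exact: rmorph_nat. Qed.

Lemma inner_deltar u x : inner u (delta R x) = u x.
Proof.
rewrite /inner (@summability_sum_finsupp _ [fset x]%fset) => [|y].
  by rewrite big_seq_fset1 conj_delta eqxx; exact: mulr1.
by rewrite conj_delta inE => /negPf ->; exact: mulr0.
Qed.

Lemma inner_deltal u x : inner (delta R x) u = (u x : R[i])^*%R.
Proof.
rewrite /inner (@summability_sum_finsupp _ [fset x]%fset) => [|y].
  by rewrite big_seq_fset1 deltaE eqxx; exact: mul1r.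
by rewrite deltaE inE => /negPf ->; exact: mul0r.
Qed.

Lemma inner_self u : inner u u = (ell2_norm u ^+ 2)%:C.
Proof.
apply: summability_sumP => e e0.
have [A Au] := sqsum_approx u e0; exists A => B AB.
have mulcj (z : R[i]) : z * z^* = (normc z ^+ 2)%:C.
  case: z => a b; rewrite /= sqr_sqrtr ?addr_ge0 ?sqr_ge0 //.
  by simpc; rewrite [b * a]mulrC addNr -!expr2.
rewrite (eq_bigr (fun x => (normc (u x) ^+ 2)%:C)) => [|x _]; last exact: mulcj.
rewrite -rmorph_sum -rmorphB /= expr0n /= addr0 sqrtr_sqr.
rewrite -/(sqsum u B) ger0_norm; last by rewrite subr_ge0 sqsum_le_norm.
by have := sqsumS u AB; lra.
Qed.

Lemma normc_inner_self u : normc (inner u u) = ell2_norm u ^+ 2.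
Proof. by rewrite inner_self /= expr0n addr0 sqrtr_sqr ger0_norm ?sqr_ge0. Qed.

End Inner.

(** * Bounded operators and approximation *)

Section Operators.
Variables (R : realType) (X : choiceType).
Local Notation C := R[i]^o.
Local Notation H := (ell2 R X).
Implicit Types (u v : H) (T S : H -> H).

(** For bounded [T] and nonnegative [M] this amounts to [opnorm T <= M]; in this form bounds add and
    compose without suprema. *)
Definition op_le T (M : R) : Prop := forall u, ell2_norm (T u) <= M * ell2_norm u.

Section Linear.
Variable T : H -> H.
Hypothesis linT : linear T.

Lemma opD u v : T (u + v) = T u + T v.
Proof. by have := linT 1 u v; rewrite !scale1r. Qed.

Lemma op0 : T 0 = 0.
Proof. by apply: (addrI (T 0)); rewrite -opD !addr0. Qed.

Lemma opZ a u : T (a *: u) = a *: T u.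
Proof. by have := linT a u 0; rewrite op0 !addr0. Qed.

Lemma opB u v : T (u - v) = T u - T v.
Proof. by rewrite opD -scaleN1r opZ scaleN1r. Qed.

Lemma op_sum I (r : seq I) (F : I -> H) :
  T (\sum_(i <- r) F i) = \sum_(i <- r) T (F i).
Proof. exact: (big_morph T opD op0). Qed.

End Linear.

Lemma bounded_op_le T : bounded_operator T -> exists2 M, 0 <= M & op_le T M.
Proof.
move=> [_ [M TM]]; exists (Num.max 0 M) => [|u]; first by rewrite le_max lexx.
by apply: le_trans (TM u) _; rewrite ler_wpM2r ?ell2_norm_ge0 // le_max lexx orbT.
Qed.

Lemma opnorm_le T (M : R) : 0 <= M -> op_le T M -> opnorm T <= M.
Proof.
move=> M0 TM; apply: ge_sup.
  by exists (ell2_norm (T 0)), 0 => //=; rewrite ell2_norm0 ler01.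
move=> _ [u /= u1 <-]; apply: le_trans (TM u) _.
by rewrite -[X in _ <= X]mulr1 ler_wpM2l.
Qed.

Lemma op_le_opnorm T : bounded_operator T -> op_le T (opnorm T).
Proof.
move=> bT u; have [linT _] := bT.
have [M M0 TM] := bounded_op_le bT.
have [u0|u0] := eqVneq (ell2_norm u) 0.
  by rewrite u0 mulr0 (ell2_norm_eq0 u0) (op0 linT) ell2_norm0.
have {u0} u0 : 0 < ell2_norm u by rewrite lt0r u0 ell2_norm_ge0.
have nc : normc ((ell2_norm u)^-1%:C) = (ell2_norm u)^-1.
  by rewrite /= expr0n addr0 sqrtr_sqr ger0_norm // invr_ge0 ltW.
rewrite -ler_pdivrMr // mulrC -nc -ell2_normZ -(opZ linT).
apply: ub_le_sup; last first.
  by exists ((ell2_norm u)^-1%:C *: u) => //=; rewrite ell2_normZ nc mulVf // gt_eqF.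
exists M => _ [v /= v1 <-]; apply: le_trans (TM v) _.
by rewrite -[X in _ <= X]mulr1 ler_wpM2l.
Qed.

Lemma op_le_trans T (M N : R) : M <= N -> op_le T M -> op_le T N.
Proof.
by move=> MN TM u; apply: le_trans (TM u) _; rewrite ler_wpM2r ?ell2_norm_ge0.
Qed.

Lemma bounded_of_op_le T (M : R) : linear T -> op_le T M -> bounded_operator T.
Proof. by move=> linT TM; split=> //; exists M. Qed.

Lemma op_leD T S (M N : R) : op_le T M -> op_le S N -> op_le (T + S) (M + N).
Proof.
move=> TM SN u; rewrite mulrDl.
exact: le_trans (ell2_normD _ _) (lerD (TM u) (SN u)).
Qed.

Lemma op_leN T (M : R) : op_le T M -> op_le (- T) M.
Proof. by move=> TM u; rewrite ell2_normN. Qed.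

Lemma op_le_comp T S (M N : R) : 0 <= M -> op_le T M -> op_le S N ->
  op_le (T \o S) (M * N).
Proof.
move=> M0 TM SN u; apply: le_trans (TM _) _.
by rewrite -mulrA ler_wpM2l.
Qed.

Lemma boundedD T S : bounded_operator T -> bounded_operator S ->
  bounded_operator (T + S).
Proof.
move=> bT bS; have [[linT _] [linS _]] := (bT, bS).
have [M _ TM] := bounded_op_le bT; have [N _ SN] := bounded_op_le bS.
apply: bounded_of_op_le (op_leD TM SN) => a u v.
by rewrite -[(T + S) _]/(T _ + S _) linT linS scalerDr addrACA.
Qed.

Lemma boundedN T : bounded_operator T -> bounded_operator (- T).
Proof.
move=> bT; have [linT _] := bT; have [M _ TM] := bounded_op_le bT.
apply: bounded_of_op_le (op_leN TM) => a u v.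
by rewrite -[(- T) _]/(- T _) linT opprD scalerN.
Qed.

Lemma boundedB T S : bounded_operator T -> bounded_operator S ->
  bounded_operator (T - S).
Proof. by move=> bT bS; apply: boundedD => //; exact: boundedN. Qed.

Lemma bounded_comp T S : bounded_operator T -> bounded_operator S ->
  bounded_operator (T \o S).
Proof.
move=> bT bS; have [[linT _] [linS _]] := (bT, bS).
have [M M0 TM] := bounded_op_le bT; have [N _ SN] := bounded_op_le bS.
apply: bounded_of_op_le (op_le_comp M0 TM SN) => a u v.
by rewrite /= linS linT.
Qed.

Lemma bounded0 : bounded_operator (0 : H -> H).
Proof.
apply: (@bounded_of_op_le _ 0) => [a u v|u]; first by rewrite scaler0 addr0.
by rewrite mul0r ell2_norm0.
Qed.

Lemma bounded_sum I (r : seq I) (F : I -> H -> H) :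
  (forall i, bounded_operator (F i)) -> bounded_operator (\sum_(i <- r) F i).
Proof.
by move=> bF; elim/big_rec: _ => [|i T _ bT]; [exact: bounded0|exact: boundedD].
Qed.

Lemma sum_opE I (r : seq I) (F : I -> H -> H) u :
  (\sum_(i <- r) F i) u = \sum_(i <- r) F i u.
Proof. by rewrite fct_sumE. Qed.

Lemma ell2_norm_trunc A u : ell2_norm (trunc A u) <= ell2_norm u.
Proof.
apply/ell2_normP => [|B]; first exact: ell2_norm_ge0.
apply: le_trans (sqsum_le_norm u B); apply: ler_sum => x _.
rewrite truncE; case: ifP => // _.
by rewrite normc0 expr0n sqr_ge0.
Qed.

(** Finitely supported vectors are dense, and some bound [N] of [T] controls the remainder. *)
Lemma op_le_trunc T (M : R) : 0 <= M -> bounded_operator T ->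
  (forall A u, ell2_norm (T (trunc A u)) <= M * ell2_norm (trunc A u)) ->
  op_le T M.
Proof.
move=> M0 bT TM u; have [linT _] := bT.
have [N N0 TN] := bounded_op_le bT.
apply/ler_addgt0Pr => e e0.
(* [N] may be zero, so the tolerance is divided by [N + 1]. *)
have N1 : 0 < N + 1 by rewrite ltr_wpDl.
have [A uA] := trunc_approx u (divr_gt0 e0 N1).
rewrite -{1}(subrK (trunc A u) u) (opD linT) addrC.
apply: le_trans (ell2_normD _ _) _; apply: lerD.
  by apply: le_trans (TM A u) _; rewrite ler_wpM2l // ell2_norm_trunc.
apply: le_trans (TN _) _; apply: le_trans (ler_wpM2l N0 uA) _.
by rewrite mulrCA ger_pMr // ler_pdivrMr // mul1r lerDl.
Qed.

Lemma op_trunc T A u : linear T ->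
  T (trunc A u) = \sum_(x <- A) u x *: T (delta R x).
Proof.
by move=> linT; rewrite /trunc op_sum //; apply: eq_bigr => x _; rewrite opZ.
Qed.

Lemma bounded_ext T S : bounded_operator T -> bounded_operator S ->
  (forall x, T (delta R x) = S (delta R x)) -> T = S.
Proof.
move=> bT bS TS; have bTS := boundedB bT bS.
have [[linT _] [linS _]] := (bT, bS).
apply: funext => u; apply/eqP; rewrite -subr_eq0; apply/eqP.
apply: ell2_norm_eq0; apply/le_anti; rewrite ell2_norm_ge0 andbT.
have : op_le (T - S) 0.
  apply: op_le_trunc => // A v; rewrite -[(T - S) _]/(T _ - S _) mul0r.
  rewrite !op_trunc // (eq_bigr _ (fun x _ => congr1 _ (TS x))).
  by rewrite subrr ell2_norm0.
by move=> /(_ u); rewrite mul0r.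
Qed.

Lemma suppP T x y : supp T (x, y) <-> T (delta R x) y != 0.
Proof. by rewrite /supp /= inner_deltar. Qed.

Lemma entry_le T (M : R) x y : op_le T M -> normc (T (delta R x) y) <= M.
Proof.
move=> TM; apply: le_trans (normc_le_norm _ _) _; apply: le_trans (TM _) _.
suff -> : ell2_norm (delta R x) = 1 by rewrite mulr1.
have := inner_self (delta R x); rewrite inner_deltar deltaE eqxx.
move=> /(congr1 (@complex.Re R)) /= /esym e.
by apply/eqP; rewrite -(@eqrXn2 _ 2) ?ell2_norm_ge0 // e expr1n.
Qed.

End Operators.

(** * Weighted shifts and operators supported on an entourage *)

Section WeightedShift.
Variables (R : realType) (X : choiceType).
Local Notation C := R[i]^o.
Local Notation H := (ell2 R X).
Implicit Types (u v : H) (h : X -> option X) (w : X -> C).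

(* [normc0] and [normc1] do not rewrite the zero and one of [R[i]^o]. *)
Lemma normcC0 : normc (0 : C) = 0. Proof. exact: normc0. Qed.
Lemma normcC1 : normc (1 : C) = 1. Proof. exact: normc1. Qed.

Definition partial_inj h :=
  forall x x' y, h x = Some y -> h x' = Some y -> x = x'.

(** [h] leads from output to input coordinates: when [h x = Some y], the matrix entry from [y] to
    [x] is [w x]. *)
Definition wshift_fun h w (u : H) : X -> C :=
  fun x => if h x is Some y then w x * u y else 0.

(** The default [0] stands for results that are not square summable; for a partial injection [h] and
    a bounded [w] this case does not arise. *)
Definition wshift h w (u : H) : H := insubd 0 (wshift_fun h w u).

Lemma uniq_pmap_partial_inj h (s : seq X) :
  partial_inj h -> uniq s -> uniq (pmap h s).
Proof.
move=> hinj; elim: s => //= x s ih /andP[xs us].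
case hx: (h x) => [y|] /=; last exact: ih.
rewrite ih // andbT mem_pmap; apply/mapP => -[x' x's /esym hx'].
by rewrite (hinj _ _ _ hx hx') x's in xs.
Qed.

(** The sum is reindexed along [h]; injectivity ensures that no coordinate of [u] is counted
    twice. *)
Lemma sqsum_wshift h w u (K : R) A : partial_inj h -> 0 <= K ->
    (forall x, normc (w x) <= K) ->
  sqsum (wshift_fun h w u) A <= (K * ell2_norm u) ^+ 2.
Proof.
move=> hinj K0 wK.
apply: (@le_trans _ _ (\sum_(y <- pmap h A) K ^+ 2 * normc (u y) ^+ 2)).
  rewrite /sqsum; elim: (enum_fset A) => [|x s ih]; first by rewrite !big_nil.
  rewrite big_cons /= /wshift_fun; case: (h x) => [y|] /=.
    rewrite big_cons; apply: lerD => //.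
    by rewrite normcM exprMn ler_wpM2r ?sqr_ge0 // ler_sqr ?nnegrE ?normc_ge0.
  by rewrite expr0n /= addr0 sqrtr0 expr0n add0r.
rewrite -mulr_sumr exprMn ler_wpM2l ?sqr_ge0 //.
have uA := uniq_pmap_partial_inj hinj (fset_uniq A).
apply: le_trans (sqsum_le_norm u [fset y in pmap h A]%fset).
rewrite /sqsum [X in X <= _](perm_big (enum_fset [fset y in pmap h A]%fset)) //.
by apply: uniq_perm => // y; rewrite in_fset.
Qed.

Section Bounded.
Variables (h : X -> option X) (w : X -> C) (K : R).
Hypotheses (hinj : partial_inj h) (K0 : 0 <= K).
Hypothesis (wK : forall x, normc (w x) <= K).

Lemma wshiftE u x : wshift h w u x = wshift_fun h w u x.
Proof.
rewrite /wshift -[LHS]/(val (insubd _ _) x) insubdK //.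
apply: (@ell2_predP _ _ _ ((K * ell2_norm u) ^+ 2)) => A.
exact: sqsum_wshift.
Qed.

Lemma wshift_le : op_le (wshift h w) K.
Proof.
move=> u; apply/ell2_normP => [|A]; first by rewrite mulr_ge0 ?ell2_norm_ge0.
rewrite /sqsum (eq_bigr _ (fun x _ => congr1 (fun z => normc z ^+ 2) (wshiftE u x))).
exact: sqsum_wshift.
Qed.

Lemma wshift_linear : linear (wshift h w).
Proof.
move=> a u v; apply: ell2_ext => x.
rewrite ell2D ell2Z !wshiftE /wshift_fun; case: (h x) => [y|].
  by rewrite ell2D ell2Z mulrDr mulrCA.
by rewrite mulr0 addr0.
Qed.

Lemma wshift_bounded : bounded_operator (wshift h w).
Proof. exact: bounded_of_op_le wshift_linear wshift_le. Qed.

Lemma wshift_delta x y :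
  wshift h w (delta R x) y = if h y == Some x then w y else 0.
Proof.
rewrite wshiftE /wshift_fun; case: (h y) => [z|//].
by rewrite deltaE; have [->|zx] := eqVneq z x;
  rewrite ?eqxx ?mulr1 //; case: eqP => [[/eqP]|]; rewrite ?(negPf zx) ?mulr0.
Qed.

End Bounded.

Definition diag w : H -> H := wshift (@Some X) w.

Lemma partial_inj_Some : partial_inj (@Some X).
Proof. by move=> x x' y [->] []. Qed.
Hint Resolve partial_inj_Some : core.

Section Diag.
Variables (w : X -> C) (K : R).
Hypotheses (wK : forall x, normc (w x) <= K).

(** When [X] is empty [K] may be negative, hence the maximum with 0. *)
Let K0 : 0 <= Num.max 0 K. Proof. by rewrite le_max lexx. Qed.
Let wK0 x : normc (w x) <= Num.max 0 K.
Proof. by rewrite le_max wK orbT. Qed.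

Lemma diagE u x : diag w u x = w x * u x.
Proof. by rewrite /diag (wshiftE partial_inj_Some K0 wK0). Qed.

Lemma diag_bounded : bounded_operator (diag w).
Proof. exact: (wshift_bounded partial_inj_Some K0 wK0). Qed.

Lemma diag_le : 0 <= K -> op_le (diag w) K.
Proof. by move=> K0'; exact: (wshift_le partial_inj_Some K0' wK). Qed.

Lemma diag_supp x y : supp (diag w) (x, y) -> x = y.
Proof.
move=> /suppP; rewrite diagE deltaE; have [->//|_] := eqVneq x y.
by rewrite mulr0 eqxx.
Qed.

End Diag.

Variable EE : set (set (X * X)).
Hypotheses (csE : coarse_structure EE) (ulfE : uniformly_locally_finite EE).

(** The neighbours of each point receive distinct colours from one finite set. The successor keeps
    the set of colours inhabited, since pairs off [E] need a colour too. *)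
Lemma ulf_index E : EE E -> exists (n : nat) (f : X -> X -> 'I_n.+1),
  forall x y y', E (x, y) -> E (x, y') -> f x y = f x y' -> y = y'.
Proof.
move=> /ulfE[n En]; exists n.
have /choice[f fP] : forall x, exists f : X -> 'I_n.+1,
    forall y y', E (x, y) -> E (x, y') -> f y = f y' -> y = y'.
  move=> x; have le : [set y | E (x, y)] #<= `I_n.+1.
    by apply: card_le_trans (En x) _; rewrite card_le_II.
  have [|f [fn finj]] := card_le_elim _ le; first by exists 0%N.
  exists (fun y => inord (f y)) => y y' Ey Ey' /(congr1 val).
  by rewrite /= !inordK ?fn //; exact: finj.
by exists f => x; exact: fP.
Qed.

(** A pair in [E] is coloured twice: by the index of [y] among the neighbours of [x], and by that of
    [x] among the neighbours of [y] for the inverse. Each class is then the graph of a map that is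
    injective. *)
Lemma band_partition E : EE E -> exists (I : finType) (h : I -> X -> option X),
  [/\ forall k, partial_inj (h k),
      forall k x y, h k y = Some x -> E (x, y),
      forall x y, E (x, y) -> exists k, h k y = Some x &
      forall k k' x y, h k y = Some x -> h k' y = Some x -> k = k'].
Proof.
move=> EEE; have [n [f finj]] := ulf_index EEE.
have [m [g ginj]] := ulf_index (coarse_inv csE EEE).
have /choice[h hP] : forall ky : ('I_n.+1 * 'I_m.+1) * X, exists o : option X,
    forall x, o = Some x <->
      [/\ E (x, ky.2), f x ky.2 = ky.1.1 & g ky.2 x = ky.1.2].
  move=> [[i j] y] /=.
  have [[x xP]|nx] := pselect (exists x, [/\ E (x, y), f x y = i & g y x = j]).
    exists (Some x) => z; split=> [[<-]//|[Ezy fz gz]]; congr Some.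
    case: xP => Exy fx gx; apply: (ginj y) => //=; by rewrite gx gz.
  by exists None => z; split=> // zP; case: nx; exists z.
exists ('I_n.+1 * 'I_m.+1)%type, (fun k y => h (k, y)); split.
- move=> k x x' y /hP[/= Eyx fx _] /hP[/= Eyx' fx' _].
  by apply: (finj y) => //; rewrite fx fx'.
- by move=> k x y /hP[].
- by move=> x y Exy; exists (f x y, g y x); apply/hP.
- by move=> [i j] [i' j'] x y /hP[/= _ <- <-] /hP[/= _ <- <-].
Qed.

(** Every bounded matrix supported on an entourage defines a bounded operator: it is a finite sum of
    weighted shifts, one for each colour. *)
Lemma band_operator E (a : X * X -> C) (K : R) : EE E -> 0 <= K ->
    (forall xy, normc (a xy) <= K) ->
  exists2 S : H -> H, bounded_operator S &
    forall x y, S (delta R x) y = if `[< E (x, y) >] then a (x, y) else 0.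
Proof.
move=> EEE K0 aK; have [I [h [hinj hE Eh huniq]]] := band_partition EEE.
pose w k y := if h k y is Some x then a (x, y) else 0.
have wK k y : normc (w k y) <= K by rewrite /w; case: (h k y); rewrite ?normcC0.
exists (\sum_(k : I) wshift (h k) (w k)).
  by apply: bounded_sum => k; exact: wshift_bounded K0 (wK k).
move=> x y; rewrite sum_opE ell2_sumE.
rewrite (eq_bigr _ (fun k _ => wshift_delta (hinj k) K0 (wK k) x y)).
case: asboolP => [/Eh[k hk]|nE].
  rewrite (bigD1 k) //= hk eqxx {1}/w hk big1 ?addr0 // => k' kk'.
  by case: eqP => // /(huniq _ _ _ _ hk) e; rewrite e eqxx in kk'.
by rewrite big1 // => k _; case: eqP => // hk; case: nE; exact: hE hk.
Qed.

(** The shifts [V k] have weight 1 and depend on [F] only; the entries of [T] go into the diagonal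
    factors. *)
Lemma band_decomposition F : EE F ->
  exists (I : finType) (V : I -> H -> H),
  (forall k, bounded_operator (V k) /\ supp (V k) `<=` F) /\
  forall T, bounded_operator T -> supp T `<=` F -> opnorm T <= 1 ->
  exists l : I -> X -> C, (forall k x, normc (l k x) <= 1) /\
    T = \sum_k (diag (l k) \o V k).
Proof.
move=> FF; have [I [h [hinj hE Eh huniq]]] := band_partition FF.
have n1 (k : I) (x : X) : normc (1 : C) <= 1 by rewrite normcC1.
exists I, (fun k => wshift (h k) (fun=> 1)); split=> [k|T bT TF T1].
  split; first exact: wshift_bounded ler01 (n1 k).
  move=> [x y] /suppP; rewrite (wshift_delta (hinj k) ler01 (n1 k)).
  by case: (h k y =P Some x) => [hk _|_]; [exact: hE hk|rewrite eqxx].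
have T1' : op_le T 1 := op_le_trans T1 (op_le_opnorm bT).
(* Colour [k] links at most one [x] to [y], so row [y] of the [k]-th piece is the single entry
   stored in [l k y]. *)
pose l k y : C := if h k y is Some x then T (delta R x) y else 0.
have lK k y : normc (l k y) <= 1.
  by rewrite /l; case: (h k y) => [x|]; [exact: entry_le|rewrite normcC0].
exists l; split=> //; apply: bounded_ext => //.
  apply: bounded_sum => k; apply: bounded_comp; first exact: diag_bounded (lK k).
  exact: wshift_bounded ler01 (n1 k).
move=> x; apply: ell2_ext => y; rewrite sum_opE ell2_sumE.
have e k : (diag (l k) \o wshift (h k) (fun=> 1)) (delta R x) y =
    if h k y == Some x then T (delta R x) y else 0.
  rewrite /= (diagE (lK k)) (wshift_delta (hinj k) ler01 (n1 k)).
  by case: eqP => [hk|]; rewrite ?mulr0 // mulr1 /l hk.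
rewrite (eq_bigr _ (fun k _ => e k)).
have [Fxy|nF] := pselect (F (x, y)).
  have [k hk] := Eh x y Fxy.
  rewrite (bigD1 k) //= hk eqxx big1 ?addr0 // => k' kk'.
  by case: eqP => // /(huniq _ _ _ _ hk) e'; rewrite e' eqxx in kk'.
rewrite big1 => [|k _]; last by case: eqP => // hk; case: nF; exact: hE hk.
by apply/eqP; apply: contrapT => /negP /suppP/TF.
Qed.

End WeightedShift.

(** * Algebraic operations in the uniform Roe algebra and on approximations *)

Section Roe.
Variables (R : realType) (X : choiceType).
Local Notation C := R[i]^o.
Local Notation H := (ell2 R X).
Implicit Types (u v : H) (T S : H -> H).
Variable EE : set (set (X * X)).
Hypotheses (csE : coarse_structure EE) (ulfE : uniformly_locally_finite EE).

Lemma roe_bounded T : uniform_roe EE T -> bounded_operator T.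
Proof. by case. Qed.

Lemma roe_of_supp T : bounded_operator T -> EE (supp T) -> uniform_roe EE T.
Proof.
move=> bT ET; split=> // e e0; exists T; split=> //.
apply: opnorm_le; first exact: ltW.
by move=> u; rewrite subrr ell2_norm0 mulr_ge0 ?ell2_norm_ge0 ?ltW.
Qed.

Lemma roe_of_suppS T E : bounded_operator T -> EE E -> supp T `<=` E ->
  uniform_roe EE T.
Proof.
by move=> bT EEE TE; apply: roe_of_supp => //; exact: (coarse_sub csE TE EEE).
Qed.

Lemma roe_diag (w : X -> C) (K : R) : (forall x, normc (w x) <= K) ->
  uniform_roe EE (diag w).
Proof.
move=> wK; apply: (roe_of_suppS (diag_bounded wK) (coarse_diag csE)).
by move=> [x y] /(diag_supp wK).
Qed.

(** By local finiteness [S (delta R x)] is finitely supported, so that [T] acts on it through a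
    finite sum. In [F \; E] the step along [E] comes first. *)
Lemma supp_comp T S E F : linear T -> EE E -> supp S `<=` E -> supp T `<=` F ->
  supp (T \o S) `<=` (F \; E)%relation.
Proof.
move=> linT EEE SE TF [x z] /suppP /= Tz.
have [n En] := ulfE EEE.
have finE : finite_set [set y | E (x, y)].
  by apply: card_le_finite (En x) _; exact: finite_II.
pose A := fset_set [set y | E (x, y)].
have Strunc : S (delta R x) = trunc A (S (delta R x)).
  apply: ell2_ext => y; rewrite truncE; case: ifPn => // yA.
  apply/eqP; apply: contraNT yA => Sy.
  by rewrite in_fset_set // inE /=; apply: SE; apply/suppP.
move: Tz; rewrite Strunc op_trunc // ell2_sumE => Tz.
have [y Ey Ty] : exists2 y, E (x, y) & T (delta R y) z != 0.
  apply: contrapT => h; move/eqP: Tz; apply; rewrite big_seq big1 // => y yA.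
  have Ey : E (x, y) by move: yA; rewrite in_fset_set // inE.
  rewrite ell2Z; have [->|Ty] := eqVneq (T (delta R y) z) 0; first by rewrite mulr0.
  by case: h; exists y.
by exists y => //; apply: TF; apply/suppP.
Qed.

Lemma supp_add T S E F : supp T `<=` E -> supp S `<=` F ->
  supp (T + S) `<=` E `|` F.
Proof.
move=> TE SF [x y] /suppP; rewrite -[(T + S) _]/(T _ + S _) ell2D => TS.
have [Tz|Tnz] := eqVneq (T (delta R x) y) 0; last by left; apply: TE; apply/suppP.
by right; apply: SF; apply/suppP; rewrite Tz add0r in TS.
Qed.

Lemma op_le_comp_sub T T' S S' (M N e e' : R) :
    linear S -> 0 <= M -> 0 <= e -> 
    op_le (T - S) e -> op_le (T' - S') e' -> op_le T' N -> op_le S M ->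
  op_le ((T \o T') - (S \o S')) (e * N + M * e').
Proof.
move=> linS M0 e0 TS TS' T'N SM.
have -> : (T \o T') - (S \o S') = ((T - S) \o T') + (S \o (T' - S')).
  apply: funext => u; rewrite -[LHS]/(T (T' u) - S (S' u)).
  rewrite -[RHS]/(T (T' u) - S (T' u) + S (T' u - S' u)) opB //.
  by rewrite addrA subrK.
by apply: op_leD; exact: op_le_comp.
Qed.

Lemma approximated_le e E T : uniform_roe EE T -> approximated EE e E T ->
  exists S, [/\ uniform_roe EE S, supp S `<=` E & op_le (T - S) e].
Proof.
move=> rT [S [rS SE TSe]]; exists S; split=> //.
apply: op_le_trans TSe _; apply: op_le_opnorm.
by apply: boundedB; exact: roe_bounded.
Qed.

Lemma approximatedP e E T S : 0 <= e -> uniform_roe EE S -> supp S `<=` E ->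
  op_le (T - S) e -> approximated EE e E T.
Proof. by move=> e0 rS SE TS; exists S; split=> //; exact: opnorm_le. Qed.

Lemma roe_approximated e T : 0 < e -> uniform_roe EE T ->
  exists2 E, EE E & approximated EE e E T.
Proof.
move=> e0 [_ /(_ e e0)[S [bS ES Se]]]; exists (supp S) => //.
by exists S; split=> //; exact: roe_of_supp.
Qed.

Lemma roe_comp T T' : uniform_roe EE T -> uniform_roe EE T' ->
  uniform_roe EE (T \o T').
Proof.
move=> rT rT'; have [bT bT'] := (roe_bounded rT, roe_bounded rT').
split=> [|e e0]; first exact: bounded_comp.
have [N N0 T'N] := bounded_op_le bT'.
have N1 : 0 < 2 * (N + 1) by rewrite mulr_gt0 // ltr_wpDl.
have e1 := divr_gt0 e0 N1.
have [E EEE /(approximated_le rT)[S [rS SE TS]]] := roe_approximated e1 rT.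
(* The tolerance for [T'] depends on the norm of the approximant [S], so [S] has to be chosen
   first. *)
have [M M0 SM] := bounded_op_le (roe_bounded rS).
have M1 : 0 < 2 * (M + 1) by rewrite mulr_gt0 // ltr_wpDl.
have e2 := divr_gt0 e0 M1.
have [F EEF /(approximated_le rT')[S' [rS' SF TS']]] := roe_approximated e2 rT'.
have linS : linear S by have [] := roe_bounded rS.
exists (S \o S'); split.
- exact: bounded_comp (roe_bounded rS) (roe_bounded rS').
- by apply: (coarse_sub csE (supp_comp linS EEF SF SE)); exact: (coarse_comp csE).
apply: opnorm_le; first exact: ltW.
apply: op_le_trans (op_le_comp_sub linS M0 (ltW e1) TS TS' T'N SM).
have h (a : R) : 0 <= a -> a / (2 * (a + 1)) <= 1 / 2.
  move=> a0; rewrite ler_pdivrMr ?mulr_gt0 ?ltr_wpDl //; lra.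
rewrite mulrAC -mulrA [M * _]mulrCA -mulrDr ger_pMr //.
by have := h _ N0; have := h _ M0; lra.
Qed.

(** The approximant of [T] is bounded by [M + e], hence the factor of [e']. *)
Lemma approximated_comp T T' E E' (M N e e' : R) :
    0 <= M -> 0 <= N -> 0 <= e -> 0 <= e' ->
    uniform_roe EE T -> uniform_roe EE T' -> EE E -> EE E' ->
    op_le T M -> op_le T' N ->
    approximated EE e E T -> approximated EE e' E' T' ->
  approximated EE (e * N + (M + e) * e') (E \; E')%relation (T \o T').
Proof.
move=> M0 N0 e0 e'0 rT rT' EEE EEE' TM T'N.
move=> /(approximated_le rT)[S [rS SE TS]] /(approximated_le rT')[S' [rS' SE' TS']].
have linS : linear S by have [] := roe_bounded rS.
apply: (@approximatedP _ _ _ (S \o S')).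
- by rewrite addr_ge0 // mulr_ge0 // addr_ge0.
- exact: roe_comp.
- exact: supp_comp.
apply: op_le_comp_sub => //; first by rewrite addr_ge0.
have -> : S = T - (T - S) by rewrite subKr.
by apply: op_leD TM _; exact: op_leN.
Qed.

Lemma approximatedS T E F (e e' : R) : e <= e' -> E `<=` F ->
  approximated EE e E T -> approximated EE e' F T.
Proof.
move=> ee' EF [S [rS SE TS]]; exists S; split=> //.
  exact: subset_trans EF.
exact: le_trans ee'.
Qed.

Lemma roe_add T T' : uniform_roe EE T -> uniform_roe EE T' ->
  uniform_roe EE (T + T').
Proof.
move=> rT rT'; have [bT bT'] := (roe_bounded rT, roe_bounded rT').
split=> [|e e0]; first exact: boundedD.
have e2 : 0 < e / 2 by rewrite divr_gt0.
have [E EEE /(approximated_le rT)[S [rS SE TS]]] := roe_approximated e2 rT.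
have [F EEF /(approximated_le rT')[S' [rS' SF TS']]] := roe_approximated e2 rT'.
exists (S + S'); split.
- exact: boundedD (roe_bounded rS) (roe_bounded rS').
- by apply: (coarse_sub csE (supp_add SE SF)); exact: (coarse_union csE).
apply: opnorm_le; first exact: ltW.
by rewrite opprD addrACA [e]splitr; exact: op_leD.
Qed.

Lemma roe0 : uniform_roe EE (0 : H -> H).
Proof.
apply: (roe_of_suppS (@bounded0 _ _) (coarse_diag csE)).
by move=> [x y] /suppP; rewrite eqxx.
Qed.

Lemma roe_sum I (r : seq I) (F : I -> H -> H) :
  (forall i, uniform_roe EE (F i)) -> uniform_roe EE (\sum_(i <- r) F i).
Proof.
move=> rF; elim: r => [|i r ih]; first by rewrite big_nil; exact: roe0.
by rewrite big_cons; exact: (roe_add (rF i) ih).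
Qed.

Lemma approximatedD T T' E E' (e e' : R) : 0 <= e -> 0 <= e' ->
    uniform_roe EE T -> uniform_roe EE T' ->
    approximated EE e E T -> approximated EE e' E' T' ->
  approximated EE (e + e') (E `|` E') (T + T').
Proof.
move=> e0 e'0 rT rT' /(approximated_le rT)[S [rS SE TS]].
move=> /(approximated_le rT')[S' [rS' SE' TS']].
apply: (@approximatedP _ _ _ (S + S')); first by rewrite addr_ge0.
- exact: roe_add.
- exact: supp_add.
by rewrite opprD addrACA; exact: op_leD.
Qed.

Lemma approximated_sum (I : choiceType) (r : seq I) (F : I -> H -> H)
    (E : I -> set (X * X)) (e : R) :
    0 <= e -> (forall i, uniform_roe EE (F i)) -> (forall i, EE (E i)) ->
    (forall i, approximated EE e (E i) (F i)) ->
  approximated EE (e *+ size r) (\bigcup_(i in [set` r]) E i) (\sum_(i <- r) F i).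
Proof.
move=> e0 rF EEE aF; elim: r => [|i r ih].
  rewrite big_nil; apply: (@approximatedP _ _ _ 0) => //.
  - exact: roe0.
  - by move=> [x y] /suppP; rewrite eqxx.
  - by move=> u; rewrite subrr ell2_norm0 mul0r.
rewrite big_cons mulrS.
have := approximatedD e0 (mulrn_wge0 _ e0) (rF i) (roe_sum r rF) (aF i) ih.
apply: approximatedS => // xy [Exy|[j jr Exy]].
  by exists i => //=; rewrite inE eqxx.
by exists j => //=; rewrite inE [j \in r]jr orbT.
Qed.

Lemma coarse_bigcup (I : choiceType) (r : seq I) (E : I -> set (X * X)) :
  (forall i, EE (E i)) -> EE (\bigcup_(i in [set` r]) E i).
Proof.
move=> EEE; elim: r => [|i r ih].
  by apply: (coarse_sub csE _ (coarse_diag csE)) => xy [].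
apply: (coarse_sub csE _ (coarse_union csE (EEE i) ih)) => xy [j] /=.
by rewrite inE => /orP[/eqP ->|jr] Exy; [left|right; exists j].
Qed.

End Roe.

Lemma continuous_sum (T : topologicalType) (K : numFieldType) (V : normedModType K)
    I (r : seq I) (f : I -> T -> V) :
  (forall i, continuous (f i)) -> continuous (fun t => \sum_(i <- r) f i t).
Proof.
move=> cf; elim: r => [|i r ih].
  rewrite (_ : (fun t => _) = cst 0); first by move=> t; exact: cvg_cst.
  by apply: funext => t; rewrite big_nil.
rewrite (_ : (fun t => _) = (fun t => f i t + \sum_(j <- r) f j t)).
  by move=> t; apply: cvgD; [exact: cf|exact: ih].
by apply: funext => t; rewrite big_cons.
Qed.

(** * Closedness of approximability *)

Section Closed.
Variables (R : realType) (X : choiceType).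
Local Notation C := R[i]^o.
Local Notation H := (ell2 R X).
Local Notation disk := (set_type (@cdisk R)).
Local Notation polydisk J := {ptws J -> disk}.

Lemma normc_continuous : continuous (@normc R : C -> R).
Proof.
move=> z A /nbhs_ballP[e e0 eA].
suff h : nbhs z (@normc R @^-1` A) by exact: h.
apply/nbhs_normcP; exists e => // w zw; apply: eA; apply: le_lt_trans zw.
rewrite ler_distl; apply/andP; split.
  have := le_normcD (w - z) z; rewrite subrK -[w - z]opprB normcN; lra.
have := le_normcD (z - w) w; rewrite subrK; lra.
Qed.

Variable EE : set (set (X * X)).
Hypotheses (csE : coarse_structure EE) (ulfE : uniformly_locally_finite EE).

(** An approximant is sought among matrices with entries in a compact product of disks. Being close
    to [Phi t] is a closed condition on the pair of [t] and the matrix, and projecting along a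
    compact factor preserves closedness. *)
Lemma approximated_closed (T : topologicalType) (Phi : T -> H -> H) (e : R)
    (E : set (X * X)) :
    0 <= e -> EE E -> (forall t, uniform_roe EE (Phi t)) ->
    (forall t, op_le (Phi t) 1) ->
    (forall x y, continuous (fun t => Phi t (delta R x) y : C)) ->
  closed [set t | approximated EE e E (Phi t)].
Proof.
move=> e0 EEE rPhi Phi1 cPhi.
(* An approximant within [e] of a contraction has norm, hence entries, at most [1 + e]. *)
pose K : R := 1 + e; have K0 : 0 < K by rewrite ltr_pwDl.
have nK : normc (K%:C : C) = K by rewrite /= expr0n addr0 sqrtr_sqr ger0_norm // ltW.
(* A point [s] encodes the matrix supported on [E] with entries [K] times the coordinates of [s]. *)
pose a (s : polydisk (X * X)%type) (xy : X * X) : C :=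
  if `[< E xy >] then (K%:C : C) * (val (s xy) : C) else 0.
have aK s xy : normc (a s xy) <= K.
  rewrite /a; case: ifP => _; last by rewrite normcC0 ltW.
  rewrite normcM nK -[X in _ <= X]mulr1 (ler_wpM2l (ltW K0)) //.
  exact: disk_normc.
have ac xy : continuous (fun s => a s xy).
  rewrite /a; case: asboolP => _; last by move=> s; apply: cst_continuous.
  have vc : continuous (val : disk -> C) by exact: initial_continuous.
  have pc := @proj_continuous (X * X)%type (fun=> disk) xy.
  have c2 : continuous (fun s : polydisk (X * X)%type => val (s xy) : C).
    by move=> s A nA; exact: (pc s _ (vc (s xy) _ nA)).
  move=> s; have Ks : (fun=> K%:C : C) @ s --> (K%:C : C).
    by apply: (@cst_continuous _ C).
  exact: (cvgM Ks (c2 s)).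
(* Coordinate [x] of the difference of the two matrices, applied to the truncation of [u] to [A]. *)
pose row (A : {fset X}) (u : H) x (ts : T * polydisk (X * X)%type) : C :=
  \sum_(y <- A) (Phi ts.1 (delta R y) x - a ts.2 (y, x)) * u y.
pose F (ABu : {fset X} * {fset X} * H) ts : R :=
  \sum_(x <- ABu.1.2) normc (row ABu.1.1 ABu.2 x ts) ^+ 2.
have rowc A u x : continuous (row A u x).
  apply: continuous_sum => y ts; apply: cvgM; last by apply: (@cst_continuous _ C).
  apply: cvgB => W nW.
    exact: (@cvg_fst _ _ (nbhs ts.1) (nbhs ts.2) _ _ (cPhi y x ts.1 _ nW)).
  exact: (@cvg_snd _ _ (nbhs ts.1) (nbhs ts.2) _ _ (ac (y, x) ts.2 _ nW)).
have Fc ABu : continuous (F ABu).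
  apply: continuous_sum => x ts.
  have h : normc (row ABu.1.1 ABu.2 x z) @[z --> ts] -->
      normc (row ABu.1.1 ABu.2 x ts).
    by move=> W nW; exact: (rowc _ _ _ ts _ (normc_continuous nW)).
  exact: (cvgM h h).
pose P := \bigcap_(ABu in [set: {fset X} * {fset X} * H])
  [set ts | F ABu ts <= (e * ell2_norm (trunc ABu.1.1 ABu.2)) ^+ 2].
have clP : closed P.
  apply: closed_bigI => ABu _.
  apply: (@closed_comp _ _ (F ABu) [set r | r <= _]) => [ts _|]; first exact: Fc.
  exact: closed_le.
rewrite (_ : [set t | _] = [set t | exists s, P (t, s)]).
  by apply: closed_proj_compact => //; exact: polydisk_compact.
have rowE A u x t s (S : H -> H) : linear S ->
    (forall x y, S (delta R x) y = a s (x, y)) ->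
    row A u x (t, s) = (Phi t - S) (trunc A u) x.
  move=> linS Sa; have [linPhi _] := roe_bounded (rPhi t).
  rewrite -[RHS]/(Phi t (trunc A u) x - S (trunc A u) x) !op_trunc // !ell2_sumE.
  rewrite -sumrB; apply: eq_bigr => y _.
  by rewrite !ell2Z -mulrBr Sa mulrC.
apply/seteqP; split=> t.
  move=> /(approximated_le (rPhi t))[S [rS SE tS]].
  have SK : op_le S K.
    have -> : S = Phi t - (Phi t - S) by rewrite subKr.
    by apply: op_leD (Phi1 t) _; exact: op_leN.
  have dP x : @cdisk R (S (delta R x.1) x.2 / K%:C).
    apply/cdiskP; rewrite normcM normcV nK ler_pdivrMr // mul1r.
    exact: entry_le.
  pose s : polydisk (X * X)%type := fun x => SigSub (mem_set (dP x)).
  have Sa x y : S (delta R x) y = a s (x, y).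
    rewrite /a; case: asboolP => [_|nE].
      rewrite /s /= mulrC divfK //; apply/eqP => /(congr1 (@normc R)).
      by rewrite nK normc0; apply/eqP; rewrite gt_eqF.
    by apply/eqP; apply: contrapT => /negP/suppP/SE.
  exists s => -[[A B] u] _ /=; rewrite /F /=.
  have [linS _] := roe_bounded rS.
  rewrite (eq_bigr _ (fun x _ =>
    congr1 (fun z => normc z ^+ 2) (rowE A u x t s S linS Sa))).
  apply: le_trans (sqsum_le_norm ((Phi t - S) (trunc A u)) B) _.
  by rewrite ler_sqr ?nnegrE ?mulr_ge0 ?ell2_norm_ge0.
move=> [s Ps].
have [S bS Sa] := band_operator csE ulfE EEE (ltW K0) (aK s).
have {}Sa x y : S (delta R x) y = a s (x, y).
  by rewrite Sa /a; case: asboolP.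
have SE : supp S `<=` E.
  by move=> [x y] /suppP; rewrite Sa /a; case: asboolP => // _; rewrite eqxx.
apply: (approximatedP e0 (roe_of_suppS csE bS EEE SE) SE).
have [linS _] := bS.
apply: op_le_trunc => //; first exact: boundedB (roe_bounded (rPhi t)) bS.
move=> A u; apply/ell2_normP => [|B]; first by rewrite mulr_ge0 ?ell2_norm_ge0.
have := Ps (A, B, u) I; rewrite /= /F /=.
by rewrite (eq_bigr _ (fun x _ =>
    congr1 (fun z => normc z ^+ 2) (rowE A u x t s S linS Sa))).
Qed.

End Closed.

(** * Scalar multiples, countable supports and products of diagonal operators *)

Section Extra.
Variables (R : realType) (X : choiceType).
Local Notation C := R[i]^o.
Local Notation H := (ell2 R X).
Variable EE : set (set (X * X)).
Hypotheses (csE : coarse_structure EE) (ulfE : uniformly_locally_finite EE).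
Implicit Types (T S : H -> H) (l m : X -> C).

Lemma op_leZ T (M K : R) (c : R[i]) : normc c <= K -> 0 <= M -> op_le T M ->
  op_le (c *: T) (K * M).
Proof.
move=> cK M0 TM u; rewrite -[(c *: T) u]/(c *: T u) ell2_normZ -mulrA.
by apply: ler_pM; rewrite ?normc_ge0 ?ell2_norm_ge0.
Qed.

(** This makes closure under scalars a case of closure under composition. *)
Lemma scale_diag (c : R[i]) T : c *: T = diag (fun=> c) \o T.
Proof.
apply: funext => u; apply: ell2_ext => x.
by rewrite /= (@diagE _ _ _ (normc c)) // => _.
Qed.

Lemma roe_scale (c : R[i]) T : uniform_roe EE T -> uniform_roe EE (c *: T).
Proof.
move=> rT; rewrite scale_diag.
have rc : uniform_roe EE (diag (fun=> c)).
  by apply: (@roe_diag _ _ _ csE _ (normc c)) => _.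
exact: (roe_comp csE ulfE rc rT).
Qed.

Lemma approximated_scale T E (e K : R) (c : R[i]) : 0 <= e -> normc c <= K ->
  uniform_roe EE T -> approximated EE e E T -> approximated EE (K * e) E (c *: T).
Proof.
move=> e0 cK rT /(approximated_le rT)[S [rS SE TS]].
have K0 : 0 <= K := le_trans (normc_ge0 c) cK.
apply: (@approximatedP _ _ _ _ _ _ (c *: S)); first exact: mulr_ge0.
- exact: roe_scale.
- move=> [x y] /suppP; rewrite -[(c *: S) _]/(c *: S _) ell2Z => cS.
  by apply: SE; apply/suppP; apply: contra_neq cS => ->; rewrite mulr0.
by rewrite -scalerBr; exact: op_leZ.
Qed.

(** Finite truncations converge to [u] in norm, so a nonzero coordinate belongs to one of countably
    many finite sets. *)
Lemma countable_support (u : H) : countable [set x | u x != 0].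
Proof.
have /choice[A AP] : forall n : nat, exists A,
    ell2_norm (u - trunc A u) <= n.+1%:R^-1.
  by move=> n; apply: trunc_approx; rewrite invr_gt0.
have cA : countable (\bigcup_n [set` A n]).
  by apply: bigcup_countable => // n _; apply: finite_set_countable; exact: finite_fset.
apply: sub_countable cA; apply: subset_card_le => x /= ux.
apply: contrapT => nA; have nx : 0 < normc (u x).
  by rewrite lt0r normc_ge0 andbT; apply: contra_neq ux; exact: eq0_normc.
have [n nlt] : exists n : nat, n.+1%:R^-1 < normc (u x).
  exists (Num.truncn (normc (u x))^-1).
  by rewrite invf_plt ?posrE // truncnS_gt.
have := le_trans (normc_le_norm (u - trunc (A n) u) x) (AP n).
rewrite ell2D ell2N truncE; case: ifPn => [xA|_].
  by case: nA; exists n.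
by rewrite subr0 leNgt nlt.
Qed.

Lemma diag_comp l m (K L : R) :
    (forall x, normc (l x) <= K) -> (forall x, normc (m x) <= L) ->
  diag l \o diag m = diag (fun x => l x * m x).
Proof.
move=> lK mL; apply: funext => u; apply: ell2_ext => x.
rewrite /= (diagE lK) (diagE mL) (@diagE _ _ _ (K * L)) ?mulrA // => y.
by rewrite normcM ler_pM ?normc_ge0.
Qed.

Lemma diagD l m (K L : R) :
    (forall x, normc (l x) <= K) -> (forall x, normc (m x) <= L) ->
  diag (fun x => l x + m x) = diag l + diag m.
Proof.
move=> lK mL; apply: funext => u; apply: ell2_ext => x.
rewrite -[RHS]/(diag l u x + diag m u x) (diagE lK) (diagE mL).
rewrite (@diagE _ _ _ (K + L)) ?mulrDl // => y.
by apply: le_trans (le_normcD _ _) _; exact: lerD.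
Qed.

Lemma diagZ l (c : R[i]) (K : R) : (forall x, normc (l x) <= K) ->
  diag (fun x => c * l x) = c *: diag l.
Proof.
move=> lK; rewrite scale_diag (@diag_comp _ _ (normc c) K) //.
Qed.

Lemma diag1 : diag (fun=> 1 : C) = id :> (H -> H).
Proof.
apply: funext => u; apply: ell2_ext => x.
by rewrite (@diagE _ _ _ 1) ?mul1r // => _; rewrite normcC1.
Qed.

Lemma normc_conj (z : R[i]) : normc (z^*)%R = normc z.
Proof. by case: z => a b; rewrite /= sqrrN. Qed.

Lemma mul_conj_normc (z : R[i]) : (z^*)%R * z = (normc z ^+ 2)%:C.
Proof.
case: z => a b; rewrite /= sqr_sqrtr ?addr_ge0 ?sqr_ge0 //.
by simpc; rewrite [b * a]mulrC addrN -!expr2.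
Qed.

Lemma diag_adjoint l (K : R) : (forall x, normc (l x) <= K) ->
  is_adjoint (diag l) (diag (fun x => ((l x : R[i])^*)%R)).
Proof.
move=> lK u v; congr summability.sum; apply: funext => x.
rewrite (diagE lK) (@diagE _ _ _ K) => [|y]; last by rewrite normc_conj.
by rewrite rmorphM /= conjCK mulrCA mulrA.
Qed.

End Extra.

(** Up to a unimodular factor [z] is a real [r] in the unit interval, the midpoint of the two points
    of the unit circle with real part [r]. *)
Lemma disk_average (R : realType) (z : R[i]) : normc z <= 1 ->
  exists p q : R[i], [/\ normc p = 1, normc q = 1 & z = 2^-1 * p + 2^-1 * q].
Proof.
move=> z1.
have [s [r [r0 r1 s1 ->]]] : exists (s : R[i]) (r : R),
    [/\ 0 <= r, r <= 1, normc s = 1 & z = s * r%:C].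
  have [->|z0] := eqVneq z 0; first by exists 1, 0; rewrite mulr0 normc1.
  have nz : normc z != 0 by apply: contra_neq z0 => /eq0_normc.
  have nzC : (normc z)%:C != 0 :> R[i] by apply: contra_neq nz => -[].
  exists (z / (normc z)%:C), (normc z); split; rewrite ?normc_ge0 ?divfK //.
  by rewrite normcM normcV /= expr0n addr0 sqrtr_sqr ger0_norm ?normc_ge0 // divff.
have t0 : 0 <= 1 - r ^+ 2 by rewrite subr_ge0 expr_le1.
exists (s * (r +i* Num.sqrt (1 - r ^+ 2))%C),
  (s * (r +i* - Num.sqrt (1 - r ^+ 2))%C).
split.
- by rewrite normcM s1 mul1r /= sqr_sqrtr // addrC subrK sqrtr1.
- by rewrite normcM s1 mul1r /= sqrrN sqr_sqrtr // addrC subrK sqrtr1.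
rewrite -mulrDr -mulrDr mulrCA; congr (_ * _).
have -> : (2^-1 : R[i]) = (2^-1)%:C by rewrite fmorphV rmorph_nat.
by simpc; congr (_ +i* _)%C; field.
Qed.

(** * Isomorphisms *)

Section Isomorphism.
Variables (R : realType) (X Y : choiceType).
Local Notation C := R[i]^o.
Local Notation HX := (ell2 R X).
Local Notation HY := (ell2 R Y).
Local Notation disk := (set_type (@cdisk R)).
Local Notation polydisk J := {ptws J -> disk}.
Variables (EE : set (set (X * X))) (FF : set (set (Y * Y))).
Hypotheses (csE : coarse_structure EE) (csF : coarse_structure FF).
Hypotheses (ulfE : uniformly_locally_finite EE).
Hypotheses (ulfF : uniformly_locally_finite FF).
Variable Phi : (HY -> HY) -> (HX -> HX).
Hypothesis isoPhi : star_isomorphism (uniform_roe FF) (uniform_roe EE) Phi.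
Local Notation AY := (uniform_roe FF).
Local Notation AX := (uniform_roe EE).
Implicit Types (T S : HY -> HY) (l m : Y -> C).

Let PhiD := star_isoD isoPhi.
Let PhiZ := star_isoZ isoPhi.
Let PhiM := star_isoM isoPhi.
Let PhiJ := star_isoJ isoPhi.

Lemma Phi_roe T : AY T -> AX (Phi T).
Proof. by have [h _ _] := star_iso_bij isoPhi; exact: h. Qed.

Lemma Phi_inj T S : AY T -> AY S -> Phi T = Phi S -> T = S.
Proof.
by have [_ h _] := star_iso_bij isoPhi => AT AS; apply: h; exact: mem_set.
Qed.

Lemma Phi_surj (Q : HX -> HX) : AX Q -> exists2 T, AY T & Phi T = Q.
Proof. by have [_ _ h] := star_iso_bij isoPhi => /h[T AT <-]; exists T. Qed.

Lemma Phi0 : Phi 0 = 0.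
Proof.
have A0 := roe0 R csF.
by rewrite -[in LHS](scale0r (0 : HY -> HY)) PhiZ // scale0r.
Qed.

Lemma Phi_sum I (r : seq I) (F : I -> HY -> HY) : (forall i, AY (F i)) ->
  Phi (\sum_(i <- r) F i) = \sum_(i <- r) Phi (F i).
Proof.
move=> AF; elim: r => [|i r ih]; first by rewrite !big_nil Phi0.
by rewrite !big_cons PhiD ?ih //; exact: roe_sum.
Qed.

Lemma diag_roe l (K : R) : (forall y, normc (l y) <= K) -> AY (diag l).
Proof. exact: roe_diag. Qed.

Lemma id_roe (Z : choiceType) (GG : set (set (Z * Z))) : coarse_structure GG ->
  uniform_roe GG (id : ell2 R Z -> ell2 R Z).
Proof.
move=> csG; rewrite -diag1; apply: (roe_diag csG (K := 1)) => _.
by rewrite normcC1.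
Qed.

(** If [Phi T = id], then [Phi id = Phi id \o Phi T = Phi T = id], by multiplicativity. *)
Lemma Phi_id : Phi id = id.
Proof.
have [T AT TI] := Phi_surj (id_roe csE).
have : Phi T = Phi id \o Phi T := PhiM (id_roe csF) AT.
by rewrite TI => /esym.
Qed.

(** Preservation of adjoints moves the left factor to the right, where it multiplies to the diagonal
    operator of squared moduli. Norms of images of diagonal operators are computed through this
    identity. *)
Lemma norm_Phi l (K : R) (u : HX) : (forall y, normc (l y) <= K) ->
  inner (Phi (diag l) u) (Phi (diag l) u) =
  inner u (Phi (diag (fun y => (normc (l y) ^+ 2)%:C : C)) u).
Proof.
move=> lK; have lJK y : normc ((l y : R[i])^*)%R <= K by rewrite normc_conj.
have h := PhiJ (diag_roe lK) (diag_roe lJK) (diag_adjoint lK).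
have dE : diag (fun y => ((l y : R[i])^*)%R : C) \o diag l =
    diag (fun y => (normc (l y) ^+ 2)%:C : C).
  rewrite (diag_comp lJK lK); congr diag; apply: funext => y.
  exact: mul_conj_normc.
have := PhiM (diag_roe lJK) (diag_roe lK); rewrite dE => ->.
exact: h.
Qed.

Lemma Phi_diag_unimodular l : (forall y, normc (l y) = 1) -> op_le (Phi (diag l)) 1.
Proof.
move=> l1 u; have lK y : normc (l y) <= 1 by rewrite l1.
rewrite mul1r -ler_sqr ?nnegrE ?ell2_norm_ge0 // -!normc_inner_self (norm_Phi _ lK).
rewrite (_ : (fun y => _) = (fun=> 1)) ?diag1 ?Phi_id //.
by apply: funext => y; rewrite l1 expr1n.
Qed.

(** A diagonal contraction is the average of two unimodular diagonal operators, whose images are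
    isometric by [norm_Phi]. *)
Lemma Phi_diag_le l : (forall y, normc (l y) <= 1) -> op_le (Phi (diag l)) 1.
Proof.
move=> lK.
have /choice[p /choice[q pq]] : forall y, exists p q : R[i],
    [/\ normc p = 1, normc q = 1 & l y = 2^-1 * p + 2^-1 * q].
  by move=> y; exact: disk_average.
have p1 y : normc (p y) = 1 by case: (pq y).
have q1 y : normc (q y) = 1 by case: (pq y).
have pK y : normc (p y) <= 1 by rewrite p1.
have qK y : normc (q y) <= 1 by rewrite q1.
have n2 : normc (2^-1 : R[i]) = 2^-1.
  have -> : (2^-1 : R[i]) = (2^-1)%:C by rewrite fmorphV rmorph_nat.
  by rewrite /= expr0n addr0 sqrtr_sqr ger0_norm // invr_ge0.
have -> : l = (fun y => 2^-1 * p y + 2^-1 * q y).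
  by apply: funext => y; case: (pq y).
have hK (r : Y -> C) : (forall y, normc (r y) <= 1) ->
    forall y, normc (2^-1 * r y) <= 2^-1.
  by move=> rK y; rewrite normcM n2 ger_pMr // invr_gt0.
rewrite (diagD (hK _ pK) (hK _ qK)) (diagZ _ pK) (diagZ _ qK).
have Ap : AY (diag p) := diag_roe pK; have Aq : AY (diag q) := diag_roe qK.
rewrite (PhiD (roe_scale csF ulfF _ Ap) (roe_scale csF ulfF _ Aq)).
rewrite (PhiZ _ Ap) (PhiZ _ Aq).
have -> : (1 : R) = 2^-1 * 1 + 2^-1 * 1 by field.
by apply: op_leD; apply: op_leZ; rewrite ?n2 ?ler01 //;
  exact: Phi_diag_unimodular.
Qed.

(* Compressing by the rank one projection [q] onto [delta x] gives
   [q (Phi b) q = t q]; pulling back, [p b p = t p] for [p = Phi^-1 q], so that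
   [t] is controlled by [b] on a single vector in the range of [p]. *)
Lemma Phi_entry_le (x : X) : exists (eta : HY) (M : R), 0 <= M /\
  forall b, AY b -> normc (Phi b (delta R x) x) <= M * ell2_norm (b eta).
Proof.
pose q : HX -> HX := diag (fun y => (y == x)%:R).
have q1 y : normc ((y == x)%:R : C) <= 1.
  by case: (y == x); rewrite ?normcC1 ?normcC0.
have qE u : q u = u x *: delta R x.
  apply: ell2_ext => y; rewrite (diagE q1) ell2Z deltaE.
  by have [->|_] := eqVneq y x; rewrite ?mul1r ?mulr1 ?mul0r ?mulr0.
have [p Ap pq] := Phi_surj (roe_diag csE q1 : AX q).
(* [p] is nonzero since its image [q] is. *)
have [w pw] : exists w, p w != 0.
  apply: contrapT => h; have p0 : p = 0.
    apply: funext => w; apply/eqP; apply: contrapT => /negP pw.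
    by apply: h; exists w.
  have := qE (delta R x); rewrite /q -/q -pq p0 Phi0 deltaE eqxx scale1r.
  move=> /(congr1 (fun u : HX => u x)); rewrite deltaE eqxx => /eqP.
  by rewrite eq_sym oner_eq0.
have eta0 : 0 < ell2_norm (p w).
  rewrite lt0r ell2_norm_ge0 andbT; apply: contra_neq pw.
  exact: ell2_norm_eq0.
have bp := roe_bounded Ap; have [linp _] := bp.
have [M M0 pM] := bounded_op_le bp.
exists (p w), (M / ell2_norm (p w)); split=> [|b Ab].
  by rewrite divr_ge0 // ltW.
set t := Phi b (delta R x) x.
have bPb := roe_bounded (Phi_roe Ab); have [linPb _] := bPb.
have Abp : AY (b \o p) := roe_comp csF ulfF Ab Ap.
have Apbp : AY (p \o (b \o p)) := roe_comp csF ulfF Ap Abp.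
have e : p \o (b \o p) = t *: p.
  apply: (Phi_inj Apbp (roe_scale csF ulfF t Ap)).
  rewrite (PhiZ t Ap) (PhiM Ap Abp) (PhiM Ab Ap) pq; apply: funext => u.
  rewrite -[LHS]/(q (Phi b (q u))) -[RHS]/(t *: q u).
  by rewrite (qE u) (opZ linPb) qE ell2Z -/t scalerA mulrC.
have : normc t * ell2_norm (p w) <= M * ell2_norm (b (p w)).
  by rewrite -ell2_normZ -[t *: p w]/((t *: p) w) -e; exact: pM.
by rewrite -ler_pdivlMr // mulrAC.
Qed.

(** By [norm_Phi] the squared norm of the column is a diagonal entry of the image of the squared
    moduli, to which [Phi_entry_le] applies. *)
Lemma Phi_diag_column_le (x : X) : exists (eta : HY) (M : R), 0 <= M /\
  forall l (K : R), (forall y, normc (l y) <= K) ->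
    ell2_norm (Phi (diag l) (delta R x)) ^+ 2 <=
    M * ell2_norm (diag (fun y => (normc (l y) ^+ 2)%:C : C) eta).
Proof.
have [eta [M [M0 etaM]]] := Phi_entry_le x; exists eta, M; split=> // l K lK.
rewrite -normc_inner_self (norm_Phi _ lK) inner_deltal normc_conj.
apply: etaM; apply: (@diag_roe _ (K ^+ 2)) => y.
rewrite /= expr0n addr0 sqrtr_sqr ger0_norm ?sqr_ge0 //.
by rewrite ler_sqr ?nnegrE ?normc_ge0 // (le_trans (normc_ge0 (l y))).
Qed.

(** On a finite set [A] the coordinates of [m] are close to those of [l]; off [A] the weights are at
    most 4 while [eta] has a small remainder. *)
Lemma diag_small_eventually (eta : HY) (M e : R) (l : polydisk Y) :
    0 <= M -> 0 < e ->
  nbhs l [set m : polydisk Y | M * ell2_norm (diag (fun y =>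
    (normc (val (l y) - val (m y) : C) ^+ 2)%:C : C) eta) < e].
Proof.
(* The final bound [M * (d * ell2_norm eta + 4 * d)] falls short of [d * c = e] by exactly [d * e];
   the summand [e] in [c] also gives [d <= 1]. *)
move=> M0 e0; pose c := M * (ell2_norm eta + 4) + e.
have c0 : 0 < c by rewrite ltr_wpDl // mulr_ge0 // addr_ge0 ?ell2_norm_ge0.
pose d := e / c; have d0 : 0 < d by exact: divr_gt0.
have d1 : d <= 1.
  by rewrite ler_pdivrMr // mul1r lerDr mulr_ge0 // addr_ge0 ?ell2_norm_ge0.
have [A etaA] := trunc_approx eta d0.
have nA : nbhs l (\bigcap_(y in [set` A])
    [set m : polydisk Y | normc (val (l y) - val (m y) : C) < d]).
  by apply: filter_bigI => y _; exact: coord_nbhs.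
apply: filterS nA => m /= mA.
pose g y : R := normc (val (l y) - val (m y) : C) ^+ 2.
have g0 y : 0 <= g y by exact: sqr_ge0.
have ng y : normc ((g y)%:C : C) = g y.
  by rewrite /= expr0n addr0 sqrtr_sqr ger0_norm.
have g4 y : normc ((g y)%:C : C) <= 4.
  rewrite ng (_ : 4 = 2 ^+ 2); last by rewrite expr2; field.
  rewrite ler_sqr ?nnegrE ?normc_ge0 //.
  apply: le_trans (le_normcD _ _) _; rewrite normcN.
  by rewrite (_ : 2 = 1 + 1) // lerD //; exact: disk_normc.
have gA y : y \in A -> g y <= d.
  move=> yA; have /ltW lt := mA y yA.
  rewrite /g expr2 -[X in _ <= X]mulr1; apply: ler_pM; rewrite ?normc_ge0 //.
  exact: le_trans lt d1.
have [linD _] : bounded_operator (diag (fun y => (g y)%:C : C)) := diag_bounded g4.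
have le1 : ell2_norm (diag (fun y => (g y)%:C : C) (trunc A eta)) <= d * ell2_norm eta.
  pose gt y : C := if y \in A then (g y)%:C else 0.
  have gtd y : normc (gt y) <= d.
    by rewrite /gt; case: ifP => yA; rewrite ?ng ?gA // normcC0 ltW.
  have -> : diag (fun y => (g y)%:C : C) (trunc A eta) = diag gt eta.
    apply: ell2_ext => y; rewrite (diagE g4) (diagE gtd) truncE /gt.
    by case: ifP => _; rewrite ?mulr0 ?mul0r.
  exact: (diag_le gtd (ltW d0)).
have le2 : ell2_norm (diag (fun y => (g y)%:C : C) eta) <= d * ell2_norm eta + 4 * d.
  rewrite -{1}(subrK (trunc A eta) eta) (opD linD) addrC.
  apply: le_trans (ell2_normD _ _) _; apply: lerD => //.
  by apply: le_trans (diag_le g4 _ _) _ => //; rewrite ler_wpM2l.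
apply: le_lt_trans (ler_wpM2l M0 le2) _.
have ed : d * c = e by rewrite /d divfK // gt_eqF.
rewrite -ed /c mulrDr -subr_gt0.
rewrite (_ : _ - _ = d * e); first exact: mulr_gt0.
ring.
Qed.

Definition pdiag (l : polydisk Y) : HY -> HY := diag (fun y => val (l y) : C).

Lemma pdiag_le1 (l : polydisk Y) y : normc (val (l y) : C) <= 1.
Proof. exact: disk_normc. Qed.

Lemma pdiag_roe (l : polydisk Y) : AY (pdiag l).
Proof. exact: (diag_roe (pdiag_le1 l)). Qed.

(** The difference of two values is an entry of the column of a diagonal operator, which
    [Phi_diag_column_le] makes small near [l]. *)
Lemma Phi_pdiag_continuous (x z : X) :
  continuous (fun l : polydisk Y => Phi (pdiag l) (delta R x) z : C).
Proof.
have [eta [M [M0 etaM]]] := Phi_diag_column_le x.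
move=> l A /nbhs_normcP[e e0 eA].
have := @diag_small_eventually eta M (e ^+ 2) l M0 (exprn_gt0 2 e0).
apply: filterS => m /= small; apply: eA.
have lm2 y : normc (val (l y) - val (m y) : C) <= 2.
  apply: le_trans (le_normcD _ _) _; rewrite normcN.
  by rewrite (_ : 2 = 1 + 1) // lerD //; exact: disk_normc.
have lmE : pdiag l = diag (fun y => val (l y) - val (m y) : C) + pdiag m.
  rewrite /pdiag -(diagD lm2 (pdiag_le1 m)); congr diag; apply: funext => y.
  by rewrite subrK.
rewrite lmE (PhiD (diag_roe lm2) (pdiag_roe m)).
rewrite -[(_ + _) _]/(Phi _ (delta R x) + Phi _ (delta R x)) ell2D addrK.
apply: le_lt_trans (normc_le_norm _ _) _.
rewrite -(ltr_sqr) ?nnegrE ?ell2_norm_ge0 ?(ltW e0) //.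
exact: le_lt_trans (etaM _ _ lm2) small.
Qed.

Lemma unit_le1 (y z : Y) : normc ((z == y)%:R : C) <= 1.
Proof. by case: (z == y); rewrite ?normcC1 ?normcC0. Qed.

Definition unit_diag (y : Y) : HY -> HY := diag (fun z => (z == y)%:R : C).

Lemma unit_diag_roe y : AY (unit_diag y).
Proof. exact: (diag_roe (unit_le1 y)). Qed.

(** The image of [unit_diag y] is nonzero on some basis vector [x], and then [y] is in the support
    of a vector that depends on [x] only. Supports being countable, [y] is determined by [x] and an
    index. *)
Lemma card_le_prod_nat : [set: Y] #<= [set: X * nat].
Proof.
have /choice[x xP] : forall y, exists x, Phi (unit_diag y) (delta R x) != 0.
  move=> y; apply: contrapT => h.
  have P0 : Phi (unit_diag y) = 0.
    apply: bounded_ext (roe_bounded (Phi_roe (unit_diag_roe y))) (bounded0 _ _) _.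
    by move=> x; apply/eqP; apply: contrapT => /negP hx; apply: h; exists x.
  have e0 := Phi_inj (unit_diag_roe y) (roe0 R csF) (etrans P0 (esym Phi0)).
  have := congr1 (fun Q : HY -> HY => Q (delta R y) y) e0.
  rewrite /unit_diag (diagE (unit_le1 y)) deltaE eqxx mulr1 => /eqP.
  by rewrite oner_eq0.
have /choice[eta etaP] : forall x, exists eta : HY, forall y,
    Phi (unit_diag y) (delta R x) != 0 -> eta y != 0.
  move=> x0; have [eta [M [M0 etaM]]] := Phi_diag_column_le x0.
  exists eta => y; apply: contra_neq => ey; apply: ell2_norm_eq0.
  apply/eqP; rewrite -sqrf_eq0; apply/eqP/le_anti; rewrite sqr_ge0 andbT.
  apply: le_trans (etaM _ _ (unit_le1 y)) _.
  rewrite (_ : diag _ eta = 0) ?ell2_norm0 ?mulr0 //.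
  apply: ell2_ext => z; rewrite (@diagE _ _ _ 1) => [|w].
    by have [->|_] := eqVneq z y; rewrite ?ey ?mulr0 // normcC0 expr0n mul0r.
  by case: (w == y); rewrite ?normcC1 ?normcC0 ?expr1n ?expr0n;
    [rewrite normcC1|rewrite normcC0].
have /choice[k kP] : forall x0, exists k : Y -> nat, forall y y',
    eta x0 y != 0 -> eta x0 y' != 0 -> k y = k y' -> y = y'.
  move=> x0; have := countable_support (eta x0).
  by move=> /(card_le_elim (ex_intro _ 0%N I))[k [_ kinj]]; exists k.
apply: (@card_le_intro _ _ _ _ (fun y => (x y, k (x y) y))) => // y y' _ _ [xy].
rewrite -xy => kk; apply: (kP (x y)) => //; first exact/etaP/xP.
by rewrite xy; exact/etaP/xP.
Qed.

Hypothesis smallE : small R EE.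

Lemma Phi_diag_approximated (e : R) : 0 < e -> exists2 E, EE E &
  forall l, (forall y, normc (l y) <= 1) -> approximated EE e E (Phi (diag l)).
Proof.
move=> e0; have e2 : 0 < e / 2 by exact: divr_gt0.
pose A E := [set l : polydisk Y | approximated EE (e / 2) E (Phi (pdiag l))].
have Amono E F : E `<=` F -> A E `<=` A F.
  by move=> EF l; exact: approximatedS.
have Acl E : EE E -> closed (A E).
  move=> EEE; apply: (approximated_closed csE ulfE (ltW e2) EEE).
  - by move=> l; exact: (Phi_roe (pdiag_roe l)).
  - by move=> l; exact: (Phi_diag_le (pdiag_le1 l)).
  - exact: Phi_pdiag_continuous.
have Acov (l : polydisk Y) : exists2 E, EE E & A E l.
  have [E EEE aE] := roe_approximated e2 (Phi_roe (pdiag_roe l)).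
  by exists E.
have [E0 EE0 [l0 nl0]] :=
  small_category csE smallE card_le_prod_nat Amono Acl Acov.
have [S finS SA] := polydisk_nbhs_finite nl0.
pose s := enum_fset (fset_set S).
(* Each coordinate in [s] is corrected by a coefficient of modulus at most 2, so all corrections
   together cost at most [2 * d * size s <= e / 2]. *)
pose d := e / (4 * (size s).+1%:R).
have d0 : 0 < d by rewrite divr_gt0 // mulr_gt0.
have /choice[Ey EyP] : forall y, exists E,
    EE E /\ approximated EE d E (Phi (unit_diag y)).
  move=> y; have [E EEE aE] := roe_approximated d0 (Phi_roe (unit_diag_roe y)).
  by exists E.
exists (E0 `|` \bigcup_(y in [set` s]) Ey y).
  apply: (coarse_union csE EE0); apply: (coarse_bigcup csE) => y.
  by case: (EyP y).
move=> l l1.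
have dl y : @cdisk R (l y) by apply/cdiskP.
(* [m] follows [l0] on [s], which places it in [A E0], and [l] elsewhere. *)
pose m : polydisk Y := fun y => if y \in s then l0 y else SigSub (mem_set (dl y)).
have mA : A E0 m.
  apply: SA => y Sy; rewrite /m ifT //.
  by rewrite /s in_fset_set // inE.
pose a y : C := l y - val (l0 y).
have a2 y : normc (a y) <= 2.
  apply: le_trans (le_normcD _ _) _; rewrite normcN.
  by rewrite (_ : 2 = 1 + 1) // lerD //; exact: disk_normc.
have lE : diag l = pdiag m + \sum_(y <- s) (a y *: unit_diag y).
  apply: funext => u; apply: ell2_ext => z; rewrite (diagE l1).
  rewrite -[(pdiag m + _) u]/(pdiag m u + (\sum_(y <- s) (a y *: unit_diag y)) u).
  rewrite ell2D sum_opE ell2_sumE /pdiag (diagE (pdiag_le1 m)).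
  have uE y : (a y *: unit_diag y) u z = a y * ((z == y)%:R * u z).
    rewrite -[(a y *: unit_diag y) u]/(a y *: unit_diag y u) ell2Z /unit_diag.
    by rewrite (diagE (unit_le1 y)).
  rewrite (eq_bigr _ (fun y _ => uE y)) /m; case: ifPn => zs.
    rewrite (big_fsetD1 z) //= eqxx mul1r big_seq big1 ?addr0 => [|y].
      by rewrite /a -mulrDl addrC subrK.
    by rewrite !inE => /andP[yz _]; rewrite eq_sym (negPf yz) mul0r mulr0.
  rewrite big_seq big1 ?addr0 // => y ys.
  by case: eqP => [zy|_]; [rewrite zy ys in zs|rewrite mul0r mulr0].
have Au y : AY (a y *: unit_diag y) := roe_scale csF ulfF (a y) (unit_diag_roe y).
rewrite lE (PhiD (pdiag_roe m) (roe_sum csF s Au)) (Phi_sum s Au).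
have Pu y : AX (Phi (a y *: unit_diag y)) := Phi_roe (Au y).
have au y : approximated EE (2 * d) (Ey y) (Phi (a y *: unit_diag y)).
  rewrite (PhiZ _ (unit_diag_roe y)).
  apply: (approximated_scale csE ulfE (ltW d0) (a2 y)); last exact: (EyP y).2.
  exact: (Phi_roe (unit_diag_roe y)).
have d20 : 0 <= 2 * d by rewrite mulr_ge0 // ltW.
have := approximated_sum csE s d20 Pu (fun y => (EyP y).1) au.
move=> /(approximatedD csE (ltW e2) (mulrn_wge0 _ d20) (Phi_roe (pdiag_roe m))
  (roe_sum csE s Pu) mA).
apply: approximatedS => //.
rewrite [X in _ <= X]splitr lerD2l -[X in X <= _]mulr_natr /d.
have : ((size s)%:R : R) <= (size s).+1%:R by rewrite ler_nat.
have : (0 : R) < (size s).+1%:R by [].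
move: (size s)%:R (size s).+1%:R => n N N0 nN.
rewrite (_ : 2 * _ * n = e / 2 * (n / N)); last by field; rewrite gt_eqF.
by rewrite ger_pMr // ler_pdivrMr // mul1r.
Qed.

(** Only the diagonal factors of the band decomposition vary with [T], and these are approximated
    uniformly, so one entourage serves all [T]. *)
Lemma Phi_band_approximated F (e : R) : FF F -> 0 < e -> exists2 E, EE E &
  forall T, AY T -> supp T `<=` F -> opnorm T <= 1 -> approximated EE e E (Phi T).
Proof.
move=> FFF e0.
have [I [V [VP TV]]] := band_decomposition R csF ulfF FFF.
have AV k : AY (V k).
  by have [bV sV] := VP k; exact: (roe_of_suppS csF bV FFF sV).
pose c := e / #|I|.+1%:R; have c0 : 0 < c by exact: divr_gt0.
have /choice[Ek EkP] : forall k : I, exists E, EE E /\ forall l,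
    (forall y, normc (l y) <= 1) ->
    approximated EE c E (Phi (diag l \o V k)).
  move=> k; have PV := Phi_roe (AV k).
  have [N N0 VN] := bounded_op_le (roe_bounded PV).
  have N2 : 0 < 2 * (N + 1) by rewrite mulr_gt0 // ltr_wpDl.
  (* The error [e1 * N + (1 + e1) * (c / 4)] is at most [c]: the second term is of size [c / 2] at
     most because [e1 <= 1], the first because of the other bound on [e1]. *)
  pose e1 := Num.min 1 (c / (2 * (N + 1))).
  have e10 : 0 < e1 by rewrite lt_min ltr01 divr_gt0.
  have [E1 EE1 E1P] := Phi_diag_approximated e10.
  have c4 : 0 < c / 4 by exact: divr_gt0.
  have [E2 EE2 E2P] := roe_approximated c4 PV.
  exists (E1 \; E2)%relation; split; first exact: (coarse_comp csE EE1 EE2).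
  move=> l l1; have Al := diag_roe l1.
  rewrite (PhiM Al (AV k)).
  have := approximated_comp csE ulfE ler01 N0 (ltW e10) (ltW c4) (Phi_roe Al) PV
    EE1 EE2 (Phi_diag_le l1) VN (E1P l l1) E2P.
  apply: approximatedS => //.
  have h1 : e1 <= 1 by rewrite ge_min lexx.
  have h2 : e1 * (2 * (N + 1)) <= c.
    by rewrite -ler_pdivlMr // ge_min lexx orbT.
  have h3 : (1 + e1) * (c / 4) <= 2 * (c / 4) by rewrite ler_wpM2r ?(ltW c4) //; lra.
  have h4 : e1 * (2 * (N + 1)) = 2 * (e1 * N) + 2 * e1 by ring.
  lra.
exists (\bigcup_(k in [set` index_enum I]) Ek k).
  by apply: (coarse_bigcup csE) => k; case: (EkP k).
move=> T AT TF T1; have [l [l1 ->]] := TV T (roe_bounded AT) TF T1.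
have Al k : AY (diag (l k)) := diag_roe (l1 k).
have AlV k : AY (diag (l k) \o V k) := roe_comp csF ulfF (Al k) (AV k).
rewrite (Phi_sum _ AlV).
have := approximated_sum csE (index_enum I) (ltW c0) (fun k => Phi_roe (AlV k))
  (fun k => (EkP k).1) (fun k => (EkP k).2 _ (l1 k)).
apply: approximatedS => //.
rewrite -mulr_natr /c mulrAC -mulrA ger_pMr // ler_pdivrMr // mul1r ler_nat.
by rewrite -sum1_size sum1_card leqnSn.
Qed.

End Isomorphism.

Theorem theorem4p4 (R : realType) (X Y : choiceType)
    (EE : set (set (X * X))) (FF : set (set (Y * Y)))
    (coarseX : coarse_structure EE) (coarseY : coarse_structure FF)
    (smallX : small R EE) (smallY : small R FF)
    (ulfX : uniformly_locally_finite EE) (ulfY : uniformly_locally_finite FF)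
    (Phi : (ell2 R Y -> ell2 R Y) -> (ell2 R X -> ell2 R X))
    (isoPhi : star_isomorphism (uniform_roe FF) (uniform_roe EE) Phi) :
  forall F, FF F -> forall e : R, 0 < e ->
    exists2 E, EE E & forall T, uniform_roe FF T -> supp T `<=` F ->
      opnorm T <= 1 -> approximated EE e E (Phi T).
Proof.
move=> F FFF e e0.
exact: (Phi_band_approximated coarseX coarseY ulfX ulfY isoPhi smallX FFF e0).
Qed.
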